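(* Let $\mathcal{T}$ be the family of Poncelet triangles inscribed in the non-circular ellipse $\mathcal{E}$ and circumscribing the nested ellipse $\mathcal{E}_c$. If a fixed point $P$ is on $\mathcal{E}$, then the locus $\mathcal{L}_{gP}$ of the isogonal conjugate of $P$ with respect to the triangles in $\mathcal{T}$ degenerates to a line minus a point $Q$, where $Q$ is the intersection of that line with the base $Z_1Z_2$ of the Poncelet triangle $PZ_1Z_2\in\mathcal{T}$ with apex $P$.
   Context: $\mathcal{E}$ is the ellipse $x^2/a^2+y^2/b^2=1$ with $a>b>0$. $\mathcal{E}_c$ is an ellipse contained in the interior of $\mathcal{E}$ such that some triangle is inscribed in $\mathcal{E}$ and has its three sides tangent to $\mathcal{E}_c$; by Poncelet's porism every point of $\mathcal{E}$ is then a vertex of exactly one such triangle, and $\mathcal{T}$ is the one-parameter family of all such triangles. The isogonal conjugate $gP$ of $P$ with respect to a triangle is the point of concurrence of the reflections of the cevians of $P$ about the corresponding angle bisectors; if $P$ has barycentric coordinates $[z_1:z_2:z_3]$ and the triangle has sidelengths $l_1,l_2,l_3$, then $gP=[l_1^2z_2z_3:l_2^2z_3z_1:l_3^2z_1z_2]$. It is undefined for the triangle having $P$ as a vertex, and is a point at infinity when $P$ is a non-vertex point of the circumcircle. The line, the base line $Z_1Z_2$ and their intersection $Q$ are taken in the projective plane (so $Q$ may be at infinity for exceptional $P$). *)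

(* Defs.v *)
From mathcomp Require Import all_boot all_order all_algebra.
From mathcomp Require Import classical_sets reals.

Set Implicit Arguments.
Unset Strict Implicit.
Unset Printing Implicit Defensive.

Import Order.TTheory GRing.Theory Num.Theory.
Local Open Scope ring_scope.
Local Open Scope classical_set_scope.

(* The Euclidean plane is 'rV[R]_2.  The real projective plane is 'rV[R]_(2 + 1)
   up to row space: a point is a nonzero row vector X, two points agree when
   (X == Y)%MS, a line is a matrix of rank 2, incidence is (X <= L)%MS. *)

Section Plane.
Variable R : realType.
Implicit Types (A B C P V : 'rV[R]_2) (S : set 'rV[R]_2).

Definition dot (u v : 'rV[R]_2) : R := (u *m v^T) 0 0.

Definition enorm (u : 'rV[R]_2) : R := Num.sqrt (dot u u).

Definition affine_point P : 'rV[R]_(2 + 1) := row_mx P 1%:M.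

Definition ideal_point (d : 'rV[R]_2) : 'rV[R]_(2 + 1) := row_mx d 0.

Definition line_at_infinity : 'M[R]_(2, 2 + 1) := row_mx 1%:M 0.

Definition join_line A B : 'M[R]_(2 + 1) :=
  (affine_point A + affine_point B)%MS.

Definition triangle A B C : Prop :=
  \rank (affine_point A + affine_point B + affine_point C)%MS = 3%N.

Definition std_ellipse (a b : R) : set 'rV[R]_2 :=
  [set X | X 0 0 ^+ 2 / a ^+ 2 + X 0 1 ^+ 2 / b ^+ 2 = 1].

Definition std_ellipse_interior (a b : R) : set 'rV[R]_2 :=
  [set X | X 0 0 ^+ 2 / a ^+ 2 + X 0 1 ^+ 2 / b ^+ 2 < 1].

(* Any centre and any orientation; circles (p = q) are included. *)
Definition is_ellipse S : Prop :=
  exists (p q : R) (c : 'rV[R]_2) (U : 'M[R]_2),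
    [/\ 0 < p, 0 < q, U *m U^T = 1%:M &
        S = [set c + Y *m U | Y in std_ellipse p q]].

(* A line is tangent to an ellipse iff it meets it in exactly one point; this
   notion is only used with S an ellipse. *)
Definition tangent_to (L : 'M[R]_(2 + 1)) S : Prop :=
  exists! T : 'rV[R]_2, S T /\ (affine_point T <= L)%MS.

Definition poncelet_triangle (E Ec : set 'rV[R]_2) A B C : Prop :=
  [/\ triangle A B C,
      [/\ E A, E B & E C] &
      [/\ tangent_to (join_line A B) Ec, tangent_to (join_line B C) Ec &
          tangent_to (join_line C A) Ec]].

(* Direction of the internal bisector of the angle at V with sides VA, VB. *)
Definition bisector_dir V A B : 'rV[R]_2 :=
  (enorm (A - V))^-1 *: (A - V) + (enorm (B - V))^-1 *: (B - V).

Definition reflect_dir (m d : 'rV[R]_2) : 'rV[R]_2 :=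
  (2 * dot d m / dot m m) *: m - d.

(* Reflection of the cevian VP about the bisector of the angle at V. *)
Definition reflected_cevian V A B P : 'M[R]_(2 + 1) :=
  (affine_point V
   + ideal_point (reflect_dir (bisector_dir V A B) (P - V)))%MS.

(* X is the point of concurrence, possibly at infinity, of the three reflected
   cevians of P.  For a nondegenerate triangle and P not a vertex, the three
   reflected cevians have exactly one common point. *)
Definition is_isogonal_conjugate A B C P (X : 'rV[R]_(2 + 1)) : Prop :=
  [/\ [/\ P != A, P != B & P != C],
      X != 0 &
      [/\ (X <= reflected_cevian A B C P)%MS,
          (X <= reflected_cevian B C A P)%MS &
          (X <= reflected_cevian C A B P)%MS]].

(* Triangles having P as a vertex contribute no point. *)
Definition isogonal_locus (E Ec : set 'rV[R]_2) P : set 'rV[R]_(2 + 1) :=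
  [set X | exists A B C,
     poncelet_triangle E Ec A B C /\ is_isogonal_conjugate A B C P X].

End Plane.
Arguments line_at_infinity {R}.

(* Main.v *)
Require Import Defs.
From mathcomp Require Import all_boot all_order all_algebra.
From mathcomp Require Import classical_sets reals.
From mathcomp Require Import ring lra.

Set Implicit Arguments.
Unset Strict Implicit.
Unset Printing Implicit Defensive.

Import Order.TTheory GRing.Theory Num.Theory.
Local Open Scope ring_scope.
Local Open Scope classical_set_scope.

(** The ellipse E is parametrized rationally with P at the parameter infinity, its
    conjugate radius n serving as second axis: [conic_pt P n t]. In this
    parametrization the chord x, y is tangent to Ec when K(x, y) = 0, for a
    symmetric polynomial K of degree 2 in each variable
    ([tangency_biquad_exists]). Let k(y) be the coefficient of x^2 in K; its roots
    are the base vertices Z1, Z2 of the triangle with apex P.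

    Poncelet. The existence of one triangle forces an algebraic condition on K
    ([cayley_of_triangle], [cayley_at_infinity]) which is equivalent to
    K(x, y) (x - y) = F(x) k(y) - F(y) k(x) for some monic cubic F
    ([bezout_biquad]). Hence the triangles without vertex P are the root triples of
    the cubics F + s k, s real, and s = infinity corresponds to P Z1 Z2
    ([triangle_in_pencil]). Conversely every F + s k has three distinct real roots
    and gives a triangle ([pencil_member_splits]): by nestedness each point of E
    has two distinct tangent lines to Ec, and no tangent line of E touches Ec
    ([hyperbolic_correspondence]).

    Isogonal conjugation. For a triangle with parameters t1, t2, t3 the barycentric
    coordinate of gP at t1 is N(t2, t3) / ((t1 - t2) (t1 - t3)) for a suitable
    scaling of the vertices, where N(x, y) is the squared length of the chord
    direction ([isogonal_conjugateP]). The resulting vector is symmetric and of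
    degree 1 in each parameter, so it is a linear function G of the cubic with roots
    t1, t2, t3 ([isogonal_vecE]). So gP runs through the points G(F) + s G(k), s real: all the
    points but G(k) of the line through G(F) and G(k). The point Q = G(k) is the
    value for s = infinity, and lies on Z1 Z2 ([cubic_isogonal_apex]).

    Nondegeneracy. The equation of Z1 Z2 takes at G(F) a value which is a sum of
    positive multiples of the numbers K(t, t), all negative because tangent lines of
    E miss Ec; so G(F) is not on Z1 Z2, whence L is a line different from Z1 Z2
    ([base_form_on_line]). If L were the line at infinity then, E not being a
    circle, some member of the pencil would vanish at the imaginary unit i,
    contradicting that its roots are real and distinct ([line_not_at_infinity]). *)

(** * Linear combinations of equations *)

Section LinearCombination.
Variable R : pzRingType.

(** Together with the two congruences below, lets a linear combination of
    hypotheses be written as a term, leaving one ring identity to check. This is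
    how a polynomial consequence of several polynomial equations is certified. *)
Lemma eq_comb (x y u v : R) : u = v -> x - y = u - v -> x = y.
Proof. by move=> -> e; apply/eqP; rewrite -subr_eq0 e subrr. Qed.

Lemma eq_add (x y u v : R) : x = y -> u = v -> x + u = y + v.
Proof. by move=> -> ->. Qed.

Lemma eq_scale (c x y : R) : x = y -> c * x = c * y.
Proof. by move=> ->. Qed.
End LinearCombination.

Local Notation "c *e h" := (eq_scale c h) (at level 40).
Local Notation "h +e k" := (eq_add h k) (at level 50, left associativity).
Ltac lincomb h := apply: (eq_comb h); ring.

(** * Three-periodic symmetric correspondences *)

Section Biquadratic.
Variable R : rcfType.
Implicit Types (x y t s : R).

(** Symmetric polynomials of degree at most 2 in each of two variables x, y are
    the quadratic polynomials in x + y and x y: qij is the coefficient of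
    (x + y)^i (x y)^j. *)
Record biquad := Biquad { q00 : R; q10 : R; q01 : R; q20 : R; q11 : R; q02 : R }.
Implicit Types q : biquad.

Definition bq_eval q x y : R :=
  q00 q + q10 q * (x + y) + q01 q * (x * y) + q20 q * (x + y) ^+ 2
  + q11 q * ((x + y) * (x * y)) + q02 q * (x * y) ^+ 2.

(** The coefficient of x^2, that is, the value at the parameter x = infinity; the
    next two definitions are the other coefficients in x. *)
Definition bq_inf q y : R := q20 q + q11 q * y + q02 q * y ^+ 2.

Definition bq_lin q y : R := q10 q + (q01 q + 2 * q20 q) * y + q11 q * y ^+ 2.

Definition bq_cst q y : R := q00 q + q10 q * y + q20 q * y ^+ 2.

Lemma bq_evalE q x y :
  bq_eval q x y = bq_inf q y * x ^+ 2 + bq_lin q y * x + bq_cst q y.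
Proof. rewrite /bq_eval /bq_inf /bq_lin /bq_cst; ring. Qed.

Lemma bq_evalC q x y : bq_eval q x y = bq_eval q y x.
Proof. rewrite /bq_eval; ring. Qed.

(** The obstruction to closing up after three steps: when q02 is not zero, it
    vanishes if and only if bq_eval is the Bezoutian of bq_inf and some monic
    cubic F, a linear system in the coefficients of F. *)
Definition cayley q : R := q20 q * (q01 q + q20 q) - q11 q * q10 q + q02 q * q00 q.

(** F is determined modulo bq_inf only, and is normalized to have no quadratic
    term; these are its two remaining coefficients. *)
Definition pencil_lin q : R := - (q01 q + q20 q) / q02 q.
Definition pencil_cst q : R := - q10 q / q02 q.

(** The members of the pencil spanned by F and bq_inf, the latter being seen as
    the cubic with a third root at infinity. *)
Definition pencil_cubic q s x : R :=
  x ^+ 3 + pencil_lin q * x + pencil_cst q + s * bq_inf q x.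

(** Poncelet's theorem for triangles in algebraic form: if y is a root of the
    member s and not of bq_inf, the parameters related to y are the two other
    roots of that member; the same identity then relates these two. *)
Lemma bezout_biquad q s x y : q02 q != 0 -> cayley q = 0 ->
  bq_eval q x y * (x - y)
    = pencil_cubic q s x * bq_inf q y - pencil_cubic q s y * bq_inf q x.
Proof.
case: q => a b c d e f /= f0; rewrite /cayley /= => qC.
have -> : a = - (d * (c + d) - e * b) / f.
  by apply: (mulIf f0); rewrite divfK //; lincomb qC.
rewrite /bq_eval /pencil_cubic /bq_inf /pencil_lin /pencil_cst /=.
by field.
Qed.

Lemma quadratic_three_roots (a b c t1 t2 t3 : R) :
    t1 != t2 -> t2 != t3 -> t3 != t1 ->
    a + b * t1 + c * t1 ^+ 2 = 0 -> a + b * t2 + c * t2 ^+ 2 = 0 ->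
    a + b * t3 + c * t3 ^+ 2 = 0 ->
  [/\ a = 0, b = 0 & c = 0].
Proof.
move=> n12 n23 n31 h1 h2 h3.
have k12 : b + c * (t1 + t2) = 0.
  by apply: (mulIf (_ : t1 - t2 != 0)); rewrite ?subr_eq0 //; lincomb (h1 +e -1 *e h2).
have k23 : b + c * (t2 + t3) = 0.
  by apply: (mulIf (_ : t2 - t3 != 0)); rewrite ?subr_eq0 //; lincomb (h2 +e -1 *e h3).
have c0 : c = 0.
  by apply: (mulIf (_ : t3 - t1 != 0)); rewrite ?subr_eq0 //; lincomb (k23 +e -1 *e k12).
have b0 : b = 0 by lincomb (k12 +e (- (t1 + t2)) *e c0).
by split=> //; lincomb (h1 +e (- t1) *e b0 +e (- t1 ^+ 2) *e c0).
Qed.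

Lemma bq_vieta q x y z : x != y -> bq_eval q x z = 0 -> bq_eval q y z = 0 ->
  bq_lin q z + (x + y) * bq_inf q z = 0.
Proof.
move=> nxy; rewrite !bq_evalE => hx hy.
by apply: (mulIf (_ : x - y != 0)); rewrite ?subr_eq0 //; lincomb (hx +e -1 *e hy).
Qed.

(** One triangle with finite parameters determines the symmetric functions
    e1, e2, e3 of its parameters, which then solve the linear system whose
    solvability is the Cayley condition. *)
Lemma cayley_of_triangle q t1 t2 t3 : t1 != t2 -> t2 != t3 -> t3 != t1 ->
  bq_eval q t1 t2 = 0 -> bq_eval q t2 t3 = 0 -> bq_eval q t3 t1 = 0 ->
  cayley q = 0.
Proof.
move=> n12 n23 n31 h12 h23 h31.
pose e1 := t1 + t2 + t3; pose e2 := t1 * t2 + t2 * t3 + t3 * t1.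
pose e3 := t1 * t2 * t3.
have [h21 h32 h13] : [/\ bq_eval q t2 t1 = 0, bq_eval q t3 t2 = 0 &
    bq_eval q t1 t3 = 0] by split; rewrite bq_evalC.
have v1 := bq_vieta n23 h21 h31; have v2 := bq_vieta n31 h32 h12.
have v3 := bq_vieta n12 h13 h23.
(* Substituting x + y = e1 - z in these three relations exhibits t1, t2, t3 as
   roots of one cubic with leading coefficient - q02; adding q02 times the
   monic cubic with the same roots leaves a polynomial of degree at most 1. *)
have [z0 z1 _] : [/\ q10 q + q20 q * e1 - q02 q * e3 = 0,
   q01 q + q20 q + q11 q * e1 + q02 q * e2 = 0 & (0 : R) = 0].
  apply: (@quadratic_three_roots _ _ _ t1 t2 t3) => //.
  - by rewrite -[RHS]v1 /bq_lin /bq_inf /e1 /e2 /e3; ring.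
  - by rewrite -[RHS]v2 /bq_lin /bq_inf /e1 /e2 /e3; ring.
  - by rewrite -[RHS]v3 /bq_lin /bq_inf /e1 /e2 /e3; ring.
have z2 : q00 q - q20 q * e2 - q11 q * e3 = 0.
  have := eq_comb (h12 +e (- (t1 + t2)) *e z0 +e (- (t1 * t2)) *e z1).
  by apply; rewrite /bq_eval /e1 /e2 /e3; ring.
rewrite /cayley.
have -> : q10 q = q02 q * e3 - q20 q * e1 by lincomb z0.
have -> : q01 q = - (q20 q + q11 q * e1 + q02 q * e2) by lincomb z1.
have -> : q00 q = q20 q * e2 + q11 q * e3 by lincomb z2.
by ring.
Qed.

Lemma bq_inf_vieta q z1 z2 : z1 != z2 -> bq_inf q z1 = 0 -> bq_inf q z2 = 0 ->
  q11 q = - q02 q * (z1 + z2) /\ q20 q = q02 q * (z1 * z2).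
Proof.
rewrite /bq_inf => n12 h1 h2.
have e : q11 q + q02 q * (z1 + z2) = 0.
  by apply: (mulIf (_ : z1 - z2 != 0)); rewrite ?subr_eq0 //; lincomb (h1 +e -1 *e h2).
by split; [lincomb e | lincomb (h1 +e (- z1) *e e)].
Qed.

(** The case of a triangle with one parameter at infinity; as an equivalence when
    q02 is not zero, it also gives back such a triangle. *)
Lemma cayley_at_infinity q z1 z2 :
  z1 != z2 -> bq_inf q z1 = 0 -> bq_inf q z2 = 0 ->
  cayley q = q02 q * bq_eval q z1 z2.
Proof.
move=> n12 h1 h2; have [e1 e2] := bq_inf_vieta n12 h1 h2.
by rewrite /cayley /bq_eval e1 e2; ring.
Qed.

Lemma quadratic_roots (a b c : R) : a != 0 -> 0 < b ^+ 2 - 4 * (a * c) ->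
  exists x1 x2, [/\ x1 != x2 & forall x,
    a * x ^+ 2 + b * x + c = a * (x - x1) * (x - x2)].
Proof.
move=> a0 D; pose r := Num.sqrt (b ^+ 2 - 4 * (a * c)).
have r2 : r ^+ 2 = b ^+ 2 - 4 * (a * c) by rewrite sqr_sqrtr ?ltW.
have r0 : r != 0 by rewrite gt_eqF // sqrtr_gt0.
exists ((- b + r) / (2 * a)), ((- b - r) / (2 * a)); split.
  rewrite -subr_eq0.
  have -> : (- b + r) / (2 * a) - (- b - r) / (2 * a) = r / a by field.
  by rewrite mulf_neq0 ?invr_neq0.
move=> x.
have -> : c = (b ^+ 2 - r ^+ 2) / (4 * a) by rewrite r2; field.
by field.
Qed.

Lemma cubic_root (c2 c1 c0 : R) :
  exists x, x ^+ 3 + c2 * x ^+ 2 + c1 * x + c0 = 0.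
Proof.
pose p : {poly R} := 'X^3 + c2 *: 'X^2 + c1 *: 'X + c0%:P.
have pE x : p.[x] = x ^+ 3 + c2 * x ^+ 2 + c1 * x + c0.
  by rewrite /p !hornerE.
have [M ME] : exists M, M = 1 + `|c2| + `|c1| + `|c0| by eexists.
have M1 : 1 <= M by rewrite ME -!addrA lerDl !addr_ge0.
have b2 := ler_norm c2; have b1 := ler_norm c1; have b0 := ler_norm c0.
have B2 := ler_norm (- c2); have B1 := ler_norm (- c1); have B0 := ler_norm (- c0).
have [x _ /rootP hx] : exists2 x, (x \in `[-M, M])%R & root p x.
  rewrite !normrN in B2 B1 B0.
  have g2 := normr_ge0 c2; have g1 := normr_ge0 c1; have g0 := normr_ge0 c0.
  apply: (@poly_ivt _ p (-M) M); first by lra.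
  rewrite !pE.
  have h1 : `|c1| * M <= `|c1| * M ^+ 2 by apply: ler_wpM2l => //; rewrite expr2 ler_peMr //; lra.
  have h0 : `|c0| * 1 <= `|c0| * M ^+ 2 by apply: ler_wpM2l => //; rewrite exprn_ege1.
  (* M is chosen so that at M and - M the leading term dominates the others. *)
  have h3 : M ^+ 3 = M ^+ 2 + `|c2| * M ^+ 2 + `|c1| * M ^+ 2 + `|c0| * M ^+ 2.
    by rewrite exprS [X in X * _]ME; ring.
  have M2 : 0 <= M ^+ 2 by rewrite exprn_ge0 //; lra.
  have M0 : 0 <= M by lra.
  have k2 := ler_wpM2r M2 b2; have K2 := ler_wpM2r M2 B2.
  have k1 := ler_wpM2r M0 b1; have K1 := ler_wpM2r M0 B1.
  have e3 : (- M) ^+ 3 = - M ^+ 3 by ring.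
  by apply/andP; split; rewrite ?e3 ?sqrrN; lra.
by exists x; rewrite -pE.
Qed.

(** What nestedness gives: the form has a constant sign on the diagonal, so no
    parameter is related to itself, and every parameter is related to two distinct
    real ones. The conditions on q02 and on the discriminant of bq_inf are the
    cases of the parameter infinity. *)
Definition hyperbolic q : Prop :=
  [/\ q02 q < 0, forall t, bq_eval q t t < 0,
      0 < q11 q ^+ 2 - 4 * (q02 q * q20 q) &
      forall t, 0 < bq_lin q t ^+ 2 - 4 * (bq_inf q t * bq_cst q t)].

(** A cubic has a real root t1; the relation with t1 is, up to a factor, the
    quotient of the member by x - t1, and hyperbolicity says that it has two
    distinct real roots different from t1. *)
Lemma pencil_member_splits q s : hyperbolic q -> cayley q = 0 ->
  exists t1 t2 t3,
    [/\ [/\ t1 != t2, t2 != t3 & t3 != t1],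
        forall x, pencil_cubic q s x = (x - t1) * (x - t2) * (x - t3) &
        [/\ bq_eval q t1 t2 = 0, bq_eval q t2 t3 = 0 & bq_eval q t3 t1 = 0]].
Proof.
move=> [q0 qd _ qD] qC; have q0' : q02 q != 0 by rewrite lt_eqF.
have [t1 r1] : exists t1, pencil_cubic q s t1 = 0.
  have [t1 r1] := cubic_root (s * q02 q) (pencil_lin q + s * q11 q)
                    (pencil_cst q + s * q20 q).
  by exists t1; rewrite -r1 /pencil_cubic /bq_inf; ring.
have k1 x : bq_eval q x t1 * (x - t1) = pencil_cubic q s x * bq_inf q t1.
  by rewrite (bezout_biquad s) // r1 mul0r subr0.
(* Otherwise x |-> bq_eval q x t1 has degree at most 1 and vanishes for x != t1,
   so its linear coefficient is zero, against the positive discriminant. *)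
have i1 : bq_inf q t1 != 0.
  apply/eqP => i1; have := qD t1; rewrite i1 mul0r mulr0 subr0.
  have k0 x : x != t1 -> bq_lin q t1 * x + bq_cst q t1 = 0.
    move=> nx; have := k1 x; rewrite i1 mulr0 => /eqP.
    by rewrite mulf_eq0 subr_eq0 (negPf nx) orbF bq_evalE i1 mul0r add0r => /eqP.
  have a1 : t1 + 1 != t1 by rewrite -subr_eq0 addrAC subrr add0r oner_eq0.
  have a2 : t1 - 1 != t1 by rewrite -subr_eq0 addrAC subrr add0r oppr_eq0 oner_eq0.
  have -> : bq_lin q t1 = 0 by have := k0 _ a1; have := k0 _ a2; lra.
  by rewrite expr0n ltxx.
have [t2 [t3 [n23 r23]]] := quadratic_roots i1 (qD t1).
have r23' x : bq_eval q x t1 = bq_inf q t1 * (x - t2) * (x - t3).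
  by rewrite bq_evalE r23.
have h2 : bq_eval q t2 t1 = 0 by rewrite r23'; ring.
have h3 : bq_eval q t3 t1 = 0 by rewrite r23'; ring.
have factored x : pencil_cubic q s x = (x - t1) * (x - t2) * (x - t3).
  by apply: (mulIf i1); rewrite -k1 r23'; ring.
have irr x y : bq_eval q x y = 0 -> x != y.
  by move=> h; apply/eqP => e; have := qd x; rewrite {2}e h ltxx.
exists t1, t2, t3; split => //.
  by split => //; [rewrite eq_sym; exact: irr | exact: irr].
split=> //; first by rewrite bq_evalC.
apply: (mulIf (_ : t2 - t3 != 0)); rewrite ?subr_eq0 //.
by rewrite (bezout_biquad s) // !factored; ring.
Qed.

(** By the Bezoutian identity, related parameters have the same value of
    - F / bq_inf, and this value is s. *)
Lemma triangle_in_pencil q t1 t2 t3 : hyperbolic q -> cayley q = 0 ->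
    t1 != t2 -> t2 != t3 -> t3 != t1 ->
    bq_eval q t1 t2 = 0 -> bq_eval q t2 t3 = 0 -> bq_eval q t3 t1 = 0 ->
  exists s, forall x, pencil_cubic q s x = (x - t1) * (x - t2) * (x - t3).
Proof.
move=> [q0 qd _ qD] qC n12 n23 n31 h12 h23 h31.
have q0' : q02 q != 0 by rewrite lt_eqF.
(* Otherwise a polynomial of degree at most 1 has the two roots t2 and t3. *)
have i1 : bq_inf q t1 != 0.
  apply/eqP => i1; have := qD t1; rewrite i1 mul0r mulr0 subr0.
  have e2 : bq_lin q t1 * t2 + bq_cst q t1 = 0.
    by rewrite -h12 bq_evalC bq_evalE i1; ring.
  have e3 : bq_lin q t1 * t3 + bq_cst q t1 = 0.
    by rewrite -h31 bq_evalE i1; ring.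
  have -> : bq_lin q t1 = 0.
    by apply: (mulIf (_ : t2 - t3 != 0)); rewrite ?subr_eq0 //; lincomb (e2 +e -1 *e e3).
  by rewrite expr0n ltxx.
pose s := - pencil_cubic q 0 t1 / bq_inf q t1.
have r1 : pencil_cubic q s t1 = 0.
  by move: i1; rewrite /s /pencil_cubic => i1; field.
have root x : bq_eval q x t1 = 0 -> x != t1 -> pencil_cubic q s x = 0.
  move=> h nx; apply: (mulIf i1).
  by have := bezout_biquad s x t1 q0' qC; rewrite h r1 !mul0r subr0 => <-.
have r2 : pencil_cubic q s t2 = 0 by apply: root; [rewrite bq_evalC | rewrite eq_sym].
have r3 := root _ h31 n31.
(* Both cubics are monic: their difference is quadratic with three roots. *)
have diff x : pencil_cubic q s x - (x - t1) * (x - t2) * (x - t3) =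
    (pencil_cst q + s * q20 q + t1 * t2 * t3)
    + (pencil_lin q + s * q11 q - (t1 * t2 + t2 * t3 + t3 * t1)) * x
    + (s * q02 q + t1 + t2 + t3) * x ^+ 2.
  by rewrite /pencil_cubic /bq_inf; ring.
have z t : pencil_cubic q s t = 0 -> (t - t1) * (t - t2) * (t - t3) = 0 ->
    (pencil_cst q + s * q20 q + t1 * t2 * t3)
    + (pencil_lin q + s * q11 q - (t1 * t2 + t2 * t3 + t3 * t1)) * t
    + (s * q02 q + t1 + t2 + t3) * t ^+ 2 = 0.
  by move=> r z; rewrite -diff r z subrr.
have [] := quadratic_three_roots n12 n23 n31 (z _ r1 _) (z _ r2 _) (z _ r3 _).
- by rewrite subrr !mul0r.
- by rewrite subrr mulr0 mul0r.
- by rewrite subrr mulr0.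
move=> a0 b0 c0.
by exists s => x; apply/eqP; rewrite -subr_eq0 diff a0 b0 c0 !mul0r !addr0.
Qed.
End Biquadratic.

(** * Reflected cevians in barycentric coordinates *)

Section Plane.
Variable R : realType.
Implicit Types (u v w b c d m A B C P V D T : 'rV[R]_2).

Lemma rV2_ext u v : u 0 0 = v 0 0 -> u 0 1 = v 0 1 -> u = v.
Proof.
move=> e0 e1; apply/rowP => -[[|[|//]] hi].
  by rewrite (_ : Ordinal hi = 0) //; apply: val_inj.
by rewrite (_ : Ordinal hi = 1) //; apply: val_inj.
Qed.

Lemma dotE u v : dot u v = u 0 0 * v 0 0 + u 0 1 * v 0 1.
Proof.
rewrite /dot mxE !big_ord_recl big_ord0 addr0 !mxE.
by rewrite (_ : lift ord0 ord0 = 1) //; apply: val_inj.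
Qed.

Definition cross u v : R := u 0 0 * v 0 1 - u 0 1 * v 0 0.

Lemma dot_eq0 u : (dot u u == 0) = (u == 0).
Proof.
apply/eqP/eqP => [|->]; last by rewrite dotE !mxE !mul0r addr0.
rewrite dotE -!expr2 => /eqP; rewrite paddr_eq0 ?sqr_ge0 // !sqrf_eq0.
by case/andP => /eqP e0 /eqP e1; apply: rV2_ext; rewrite ?e0 ?e1 !mxE.
Qed.

Lemma dot_ge0 u : 0 <= dot u u.
Proof. by rewrite dotE -!expr2 addr_ge0 ?sqr_ge0. Qed.

Lemma dot_gt0 u : u != 0 -> 0 < dot u u.
Proof. by rewrite lt0r dot_ge0 dot_eq0 => ->. Qed.

Lemma lagrange2 u v : dot u u * dot v v = dot u v ^+ 2 + cross u v ^+ 2.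
Proof. by rewrite !dotE /cross; ring. Qed.

Lemma cross_neq0l u v : cross u v != 0 -> u != 0.
Proof. by apply: contraNneq => ->; rewrite /cross !mxE !mul0r subrr. Qed.

Lemma crossC u v : cross u v = - cross v u.
Proof. by rewrite /cross; ring. Qed.

Lemma cross_linear_l (y z : R) u v w :
  cross (y *: u + z *: v) w = y * cross u w + z * cross v w.
Proof. by rewrite /cross !mxE; ring. Qed.

Lemma cross_scale_self (k : R) u : cross (k *: u) u = 0.
Proof. by rewrite /cross !mxE; ring. Qed.

Lemma cross_frame b c d : cross b c != 0 -> cross d b = 0 -> cross d c = 0 -> d = 0.
Proof.
move=> bc db dc; apply: rV2_ext; rewrite [RHS]mxE; apply: (mulIf bc); rewrite mul0r.
  by move: db dc; rewrite /cross => db dc; lincomb (- c 0 0 *e db +e b 0 0 *e dc).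
by move: db dc; rewrite /cross => db dc; lincomb (- c 0 1 *e db +e b 0 1 *e dc).
Qed.

Lemma cross_eq0_collinear r u : r != 0 -> cross u r = 0 -> exists k, u = k *: r.
Proof.
move=> r0 h; have rr : dot r r != 0 by rewrite dot_eq0.
exists (dot u r / dot r r); move: h rr; rewrite !dotE /cross => h rr.
by apply: rV2_ext; rewrite !mxE; apply: (mulIf rr); rewrite mulrAC divfK //;
  [lincomb (r 0 1 *e h) | lincomb (- r 0 0 *e h)].
Qed.

Lemma sub_adds_rV n (X U V : 'rV[R]_n) :
  (X <= U + V)%MS <-> exists k l, X = k *: U + l *: V.
Proof.
split=> [/sub_addsmxP [[x y] /= ->]|[k [l ->]]].
  exists (x 0 0), (y 0 0).
  by rewrite -!mul_scalar_mx -!mx11_scalar.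
by rewrite addmx_sub_adds ?scalemx_sub.
Qed.

Lemma scale_affine k A : k *: affine_point A = row_mx (k *: A) (k%:M : 'M[R]_1).
Proof. by rewrite /affine_point scale_row_mx scale_scalar_mx mulr1. Qed.

Lemma row_mx_scalar_inj (u v : 'rV[R]_2) (k l : R) :
  row_mx u (k%:M : 'M[R]_1) = row_mx v l%:M -> u = v /\ k = l.
Proof. by case/eq_row_mx => -> /matrixP/(_ 0 0); rewrite !mxE. Qed.

Definition isogonal_dir b c d : 'rV[R]_2 :=
  reflect_dir ((enorm b)^-1 *: b + (enorm c)^-1 *: c) d.

Lemma isogonal_dirC b c d : isogonal_dir b c d = isogonal_dir c b d.
Proof. by rewrite /isogonal_dir addrC. Qed.

(** In complex notation the reflection of d is a positive multiple of
    b c (conjugate of d), so pairing it with b leaves |b|^2 times the imaginary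
    part of c (conjugate of d). *)
Lemma cross_isogonal_dir b c d : cross b c != 0 ->
  enorm b * enorm c * cross b (isogonal_dir b c d) = dot b b * cross d c.
Proof.
move=> bc.
have b0 := cross_neq0l bc.
have c0 : c != 0 by move: bc; rewrite crossC oppr_eq0 => /cross_neq0l.
have nb : enorm b != 0 by rewrite gt_eqF // sqrtr_gt0 dot_gt0.
have nc : enorm c != 0 by rewrite gt_eqF // sqrtr_gt0 dot_gt0.
have sb : enorm b ^+ 2 = dot b b by rewrite sqr_sqrtr ?dot_ge0.
have sc : enorm c ^+ 2 = dot c c by rewrite sqr_sqrtr ?dot_ge0.
rewrite /isogonal_dir; set u := _ *: b; set v := _ *: c.
have eb : b = enorm b *: u by rewrite scalerA divff // scale1r.
have ec : c = enorm c *: v by rewrite scalerA divff // scale1r.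
have uu : dot u u = 1.
  have -> : dot u u = (enorm b)^-1 ^+ 2 * dot b b by rewrite !dotE !mxE; ring.
  by rewrite -sb -exprMn mulVf // expr1n.
have vv : dot v v = 1.
  have -> : dot v v = (enorm c)^-1 ^+ 2 * dot c c by rewrite !dotE !mxE; ring.
  by rewrite -sc -exprMn mulVf // expr1n.
clearbody u v.
have uv : cross u v != 0.
  apply: contraNneq bc => uv; rewrite eb ec /cross !mxE; apply/eqP.
  by move: uv; rewrite /cross => uv; lincomb (enorm b * enorm c *e uv).
set m := u + v.
have mm : dot m m != 0.
  rewrite dot_eq0; apply: contraNneq uv => m0; apply/eqP.
  have -> : v = - u by apply/eqP; rewrite -addr_eq0 addrC -/m m0.
  by rewrite /cross !mxE; ring.
(* Decomposing d along m = u + v and v - u, which are orthogonal since u and v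
   have the same length. *)
have key : 2 * dot d m * cross u m = dot m m * cross u d + dot m m * cross d v.
  have := eq_comb (cross m d *e (eq_add vv (eq_scale (-1) uu))).
  apply; rewrite /m !dotE /cross !mxE; ring.
have eL : cross b (reflect_dir m d)
    = enorm b * (2 * dot d m * cross u m / dot m m - cross u d).
  by rewrite {1}eb /reflect_dir /cross !mxE; ring.
have eR : cross d c = enorm c * cross d v by rewrite {1}ec /cross !mxE; ring.
by rewrite eL eR key -sb; field.
Qed.

Lemma isogonal_dir_neq0 b c d : cross b c != 0 -> d != 0 -> isogonal_dir b c d != 0.
Proof.
move=> bc; apply: contraNneq => r0; have cb : cross c b != 0 by rewrite crossC oppr_eq0.
have b0 : dot b b != 0 by rewrite dot_eq0 (cross_neq0l bc).
have c0 : dot c c != 0 by rewrite dot_eq0 (cross_neq0l cb).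
have cr0 w : cross w 0 = 0 by rewrite /cross !mxE; ring.
apply/eqP; apply: (cross_frame bc).
  apply: (mulfI c0); rewrite mulr0 -(cross_isogonal_dir _ cb).
  by rewrite isogonal_dirC r0 cr0 mulr0.
apply: (mulfI b0); rewrite mulr0 -(cross_isogonal_dir _ bc).
by rewrite r0 cr0 mulr0.
Qed.

Lemma affine_combination A B C (x y z : R) :
  x *: affine_point A + y *: affine_point B + z *: affine_point C =
  row_mx ((x + y + z) *: A + (y *: (B - A) + z *: (C - A)))
         ((x + y + z)%:M : 'M[R]_1).
Proof.
rewrite !scale_affine !add_row_mx; congr row_mx; last first.
  by apply/matrixP => i j; rewrite !mxE -!mulrnDl.
by apply: rV2_ext; rewrite !mxE; ring.
Qed.

(** The two cross products are, up to sign, the barycentric coordinates z2 and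
    z3 of P, so this is the line y |AB|^2 z2 = z |AC|^2 z3 through A and the
    point [l1^2 z2 z3 : l2^2 z3 z1 : l3^2 z1 z2]. *)
Lemma reflected_cevian_barycentric A B C P (x y z : R) :
    cross (B - A) (C - A) != 0 -> P != A ->
  ((x *: affine_point A + y *: affine_point B + z *: affine_point C)%R
     <= reflected_cevian A B C P)%MS <->
  y * dot (B - A) (B - A) * cross (C - A) (P - A)
    + z * dot (C - A) (C - A) * cross (B - A) (P - A) = 0.
Proof.
set b := B - A; set c := C - A; set d := P - A => bc PA.
have d0 : d != 0 by rewrite subr_eq0.
have cb : cross c b != 0 by rewrite crossC oppr_eq0.
have r0 := isogonal_dir_neq0 bc d0; set r := isogonal_dir b c d in r0.
have nn : enorm b * enorm c != 0.
  have := cross_neq0l bc; have := cross_neq0l cb => c0 b0.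
  by rewrite mulf_neq0 // gt_eqF // sqrtr_gt0 dot_gt0.
have crE : enorm b * enorm c * cross (y *: b + z *: c) r =
    - (y * dot b b * cross c d + z * dot c c * cross b d).
  have h1 := cross_isogonal_dir d bc; rewrite -/r in h1.
  have h2 := cross_isogonal_dir d cb; rewrite isogonal_dirC -/r in h2.
  rewrite cross_linear_l (crossC c d) (crossC b d). lincomb (y *e h1 +e z *e h2).
rewrite affine_combination -/b -/c.
rewrite /reflected_cevian -/d -[reflect_dir _ _]/r; split.
  case/sub_adds_rV => k [l]; rewrite scale_affine /ideal_point scale_row_mx add_row_mx.
  rewrite scaler0 addr0 => /row_mx_scalar_inj [e ek].
  rewrite ek in e; move/addrI: e => e.
  by apply: oppr_inj; rewrite oppr0 -crE e cross_scale_self mulr0.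
move=> h; rewrite h oppr0 in crE.
have /(cross_eq0_collinear r0) [l ->] : cross (y *: b + z *: c) r = 0.
  by move/eqP: crE; rewrite mulf_eq0 (negPf nn) => /eqP.
apply/sub_adds_rV; exists (x + y + z), l.
by rewrite scale_affine /ideal_point scale_row_mx add_row_mx scaler0 addr0.
Qed.

End Plane.

(** * Lines tangent to an ellipse *)

Section Tangency.
Variable R : realType.
Implicit Types (u v w b c d m A B C P V D T : 'rV[R]_2).

(** An ellipse as the preimage of the unit circle by an affine isomorphism; this
    avoids distinguishing axes, centre and orientation afterwards. *)
Definition quadric (c : 'rV[R]_2) (H : 'M[R]_2) : set 'rV[R]_2 :=
  [set X | dot ((X - c) *m H) ((X - c) *m H) = 1].

Lemma is_ellipse_quadric (S : set 'rV[R]_2) : is_ellipse S ->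
  exists (c : 'rV[R]_2) (H : 'M[R]_2), H \in unitmx /\ S = quadric c H.
Proof.
move=> [p [q [c [U [p0 q0 UU ->]]]]].
pose g : 'rV[R]_2 := \row_j (if j == 0 then p^-1 else q^-1).
have VU : U^T *m U = 1%:M by exact: mulmx1C.
have dg (Y : 'rV[R]_2) : dot (Y *m diag_mx g) (Y *m diag_mx g) =
    Y 0 0 ^+ 2 / p ^+ 2 + Y 0 1 ^+ 2 / q ^+ 2.
  by rewrite mul_mx_diag dotE !mxE /=; field; rewrite !gt_eqF.
exists c, (U^T *m diag_mx g); split.
  rewrite unitmx_mul unitmx_tr; case: (mulmx1_unit UU) => -> _ /=.
  rewrite unitmxE det_diag unitfE; apply/prodf_neq0 => i _.
  by rewrite mxE; case: ifP => _; rewrite invr_neq0 // gt_eqF.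
apply/seteqP; split => X /=.
  case=> Y; rewrite /std_ellipse /quadric /= => hY <-.
  by rewrite [c + _]addrC addrK !mulmxA -!(mulmxA Y) UU mul1mx dg.
rewrite /quadric /= !mulmxA dg => h; exists ((X - c) *m U^T) => //.
by rewrite -mulmxA VU mulmx1 addrC subrK.
Qed.

Lemma cross_mulmx (H : 'M[R]_2) : H \in unitmx ->
  exists2 k, k != 0 & forall u v, cross (u *m H) (v *m H) = k * cross u v.
Proof.
move=> hH; pose k := H 0 0 * H 1 1 - H 0 1 * H 1 0.
have e u i : (u *m H) 0 i = u 0 0 * H 0 i + u 0 1 * H 1 i.
  rewrite mxE !big_ord_recl big_ord0 addr0.
  by rewrite (_ : lift ord0 ord0 = 1) //; apply: val_inj.
have kE u v : cross (u *m H) (v *m H) = k * cross u v.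
  by rewrite /cross !e /k; ring.
exists k => //; apply/eqP => k0.
pose e0 : 'rV[R]_2 := delta_mx 0 0; pose e1 : 'rV[R]_2 := delta_mx 0 1.
have := kE (e0 *m invmx H) (e1 *m invmx H).
rewrite !mulmxKV // k0 mul0r /cross /e0 /e1 !mxE /= => /eqP.
by rewrite !(mul1r, mul0r, mulr0, subr0) oner_eq0.
Qed.

Lemma quadratic_unique_root (a b c : R) : 0 < a ->
  (exists! k, a * k ^+ 2 + 2 * b * k + c = 0) <-> b ^+ 2 - a * c = 0.
Proof.
move=> a0; have a0' : a != 0 by rewrite gt_eqF.
split.
  (* k' is the other root by Vieta, so k is the double root - b / a. *)
  case=> k [hk uk]; pose k' := - 2 * b / a - k.
  have /uk e : a * k' ^+ 2 + 2 * b * k' + c = 0 by rewrite -[RHS]hk /k'; field.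
  have {}e : a * k + b = 0.
    have : k' + k = - 2 * b / a by rewrite /k'; ring.
    by rewrite -e => e2; apply: (mulfI (_ : 2 / a != 0)); [
      rewrite mulf_neq0 ?invr_neq0 // pnatr_eq0 |
      rewrite (_ : b = - (k + k) * a / 2); [field | rewrite e2; field]].
  have : (a * k + b) ^+ 2 = b ^+ 2 - a * c by lincomb (a *e hk).
  by rewrite e expr0n.
move=> D; have eq k : a * (a * k ^+ 2 + 2 * b * k + c) = (a * k + b) ^+ 2.
  by lincomb (-1 *e D).
exists (- b / a); split.
  by apply: (mulfI a0'); rewrite eq; field.
move=> k hk; have := eq k; rewrite hk mulr0 => /esym/eqP; rewrite sqrf_eq0 => /eqP e.
by apply: (mulfI a0'); rewrite mulrC divfK //; lincomb (-1 *e e).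
Qed.

(** The reduced discriminant of the equation of the quadric along the line
    V + k D, rewritten with Lagrange's identity: it is positive for a secant line,
    zero for a tangent one, and negative for a line that misses the quadric. *)
Definition line_disc (c : 'rV[R]_2) (H : 'M[R]_2) V D : R :=
  dot (D *m H) (D *m H) - cross ((V - c) *m H) (D *m H) ^+ 2.

Lemma quadric_on_line c H V D (k : R) :
  quadric c H (V + k *: D) <->
  dot (D *m H) (D *m H) * k ^+ 2 + 2 * dot ((V - c) *m H) (D *m H) * k
   + (dot ((V - c) *m H) ((V - c) *m H) - 1) = 0.
Proof.
rewrite /quadric /= addrAC mulmxDl -scalemxAl.
set x := (V - c) *m H; set y := D *m H; clearbody x y.
have -> : dot (x + k *: y) (x + k *: y) =
   dot y y * k ^+ 2 + 2 * dot x y * k + dot x x by rewrite !dotE !mxE; ring.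
by split=> h; [lincomb h | lincomb h].
Qed.

Lemma line_discE c H V D :
  dot ((V - c) *m H) (D *m H) ^+ 2
    - dot (D *m H) (D *m H) * (dot ((V - c) *m H) ((V - c) *m H) - 1)
  = line_disc c H V D.
Proof. rewrite /line_disc; have := lagrange2 ((V - c) *m H) (D *m H) => h; lincomb (-1 *e h). Qed.

Lemma mulmx_unit_neq0 (H : 'M[R]_2) D : H \in unitmx -> D != 0 -> D *m H != 0.
Proof.
move=> hH; apply: contraNneq => h; apply/eqP.
by rewrite -(mulmxK hH D) h mul0mx.
Qed.

Lemma line_meets_quadric c H V D : H \in unitmx -> D != 0 ->
  0 <= line_disc c H V D -> exists k, quadric c H (V + k *: D).
Proof.
move=> hH D0 d0; have a0 := dot_gt0 (mulmx_unit_neq0 hH D0).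
rewrite -line_discE in d0; move: (sqr_sqrtr d0) => r2.
exists ((Num.sqrt (dot ((V - c) *m H) (D *m H) ^+ 2
    - dot (D *m H) (D *m H) * (dot ((V - c) *m H) ((V - c) *m H) - 1))
   - dot ((V - c) *m H) (D *m H)) / dot (D *m H) (D *m H)).
apply/quadric_on_line; apply: (mulfI (lt0r_neq0 a0)); rewrite mulr0.
move: r2 a0; set r := Num.sqrt _; set a := dot (D *m H) _; set b := dot _ (D *m H).
set e := _ - 1; clearbody r a b e => r2 a0; have a0' : a != 0 by rewrite gt_eqF.
have -> : a * (a * ((r - b) / a) ^+ 2 + 2 * b * ((r - b) / a) + e)
  = r ^+ 2 - (b ^+ 2 - a * e) by field.
by rewrite r2 subrr.
Qed.

Lemma on_join_line A B T :
  (affine_point T <= join_line A B)%MS <-> exists k, T = A + k *: (B - A).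
Proof.
have comb (k l : R) : k *: affine_point A + l *: affine_point B
    = row_mx (k *: A + l *: B) ((k + l)%:M : 'M[R]_1).
  rewrite !scale_affine add_row_mx; congr row_mx.
  by apply/matrixP => i j; rewrite !mxE -mulrnDl.
split=> [/sub_adds_rV [k [l]]|[k ->]].
  rewrite comb => /row_mx_scalar_inj [-> e]; exists l.
  have -> : k = 1 - l by rewrite e addrK.
  by apply: rV2_ext; rewrite !mxE; ring.
apply/sub_adds_rV; exists (1 - k), k; rewrite comb subrK.
by congr row_mx; apply: rV2_ext; rewrite !mxE; ring.
Qed.

Lemma tangent_line_disc c H A B : H \in unitmx -> A != B ->
  tangent_to (join_line A B) (quadric c H) <-> line_disc c H A (B - A) = 0.
Proof.
move=> hH AB; have D0 : B - A != 0 by rewrite subr_eq0 eq_sym.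
have a0 := dot_gt0 (mulmx_unit_neq0 hH D0).
rewrite -line_discE; apply: iff_trans (quadratic_unique_root _ _ a0).
split.
  case=> T [[ST /on_join_line [k eT]] uT]; rewrite eT in ST uT.
  exists k; split; first by apply/quadric_on_line.
  move=> l /quadric_on_line Sl; have e : A + k *: (B - A) = A + l *: (B - A).
    by apply: uT; split=> //; apply/on_join_line; exists l.
  move/addrI/eqP: e; rewrite -subr_eq0 -scalerBl scaler_eq0 (negPf D0) orbF.
  by rewrite subr_eq0 => /eqP.
case=> k [/quadric_on_line Sk uk]; exists (A + k *: (B - A)); split.
  by split => //; apply/on_join_line; exists k.
move=> T [ST /on_join_line [l eT]]; rewrite eT in ST *.
by rewrite (uk l) //; apply/quadric_on_line.
Qed.

Lemma line_disc_scale c H V D (k l : R) :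
  line_disc c H (V + l *: D) (k *: D) = k ^+ 2 * line_disc c H V D.
Proof.
rewrite /line_disc addrAC mulmxDl -!scalemxAl.
set x := (V - c) *m H; set y := D *m H; clearbody x y.
by rewrite !dotE /cross !mxE; ring.
Qed.

End Tangency.

(** * Chords of a rationally parametrized ellipse *)

Section ConicParametrization.
Variable R : realType.
Implicit Types (u v w c m n A B C P V D T X : 'rV[R]_2) (x y z t s : R).

(** The rational parametrization of the ellipse with conjugate radii m and n, by
    the half-angle cotangent; m is the point of parameter infinity. *)
Definition conic_pt m n t : 'rV[R]_2 :=
  (t ^+ 2 + 1)^-1 *: ((t ^+ 2 - 1) *: m + (2 * t) *: n).

(** The direction of the chord with parameters x and y, of the tangent line when
    x = y. It is linear in each parameter, and its leading coefficient
    m - y n is the direction of the chord from parameter y to infinity. *)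
Definition chord_dir m n x y : 'rV[R]_2 := (x + y) *: m + (1 - x * y) *: n.

Lemma sqr1_neq0 t : t ^+ 2 + 1 != 0.
Proof. by rewrite gt_eqF // ltr_wpDl ?sqr_ge0. Qed.

Lemma conic_ptB m n x y : conic_pt m n x - conic_pt m n y =
  (2 * (x - y) / ((x ^+ 2 + 1) * (y ^+ 2 + 1))) *: chord_dir m n x y.
Proof.
have hx := sqr1_neq0 x; have hy := sqr1_neq0 y.
by apply: rV2_ext; rewrite !mxE; field; rewrite hx hy.
Qed.

Lemma conic_pt_to_apex m n t :
  m - conic_pt m n t = (2 / (t ^+ 2 + 1)) *: (m - t *: n).
Proof.
have ht := sqr1_neq0 t.
by apply: rV2_ext; rewrite !mxE; field.
Qed.

Lemma cross_comb (x y z t : R) u v :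
  cross (x *: u + y *: v) (z *: u + t *: v) = (x * t - y * z) * cross u v.
Proof. by rewrite /cross !mxE; ring. Qed.

Lemma cross_chord_dir m n x y z :
  cross (chord_dir m n x y) (chord_dir m n x z) =
  (y - z) * (x ^+ 2 + 1) * cross m n.
Proof. by rewrite cross_comb; ring. Qed.

Lemma cross_chord_apex m n x y :
  cross (chord_dir m n x y) (m - x *: n) = - (x ^+ 2 + 1) * cross m n.
Proof. by rewrite -[m in m - _]scale1r -scaleNr cross_comb; ring. Qed.

Lemma cross_apex_dirs m n x y :
  cross (m - x *: n) (m - y *: n) = (x - y) * cross m n.
Proof. by rewrite /cross !mxE; ring. Qed.

Lemma crossNN u v : cross (- u) (- v) = cross u v.
Proof. by rewrite /cross !mxE; ring. Qed.

Lemma cross_scale (x y : R) u v : cross (x *: u) (y *: v) = x * y * cross u v.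
Proof. by rewrite /cross !mxE; ring. Qed.

Lemma chord_dirC m n x y : chord_dir m n x y = chord_dir m n y x.
Proof. by rewrite /chord_dir (addrC x) (mulrC x). Qed.

Lemma cross_conic_pts m n x y z :
  cross (conic_pt m n y - conic_pt m n x) (conic_pt m n z - conic_pt m n x) =
  4 * (y - x) * (z - x) * (y - z)
   / ((x ^+ 2 + 1) * (y ^+ 2 + 1) * (z ^+ 2 + 1)) * cross m n.
Proof.
rewrite !conic_ptB cross_scale.
rewrite (chord_dirC m n y) (chord_dirC m n z) cross_chord_dir.
have hx := sqr1_neq0 x; have hy := sqr1_neq0 y; have hz := sqr1_neq0 z.
by field; rewrite hx hy hz.
Qed.

Lemma cross_apex_conic_pts m n y z :
  cross (conic_pt m n y - m) (conic_pt m n z - m) =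
  4 * (y - z) / ((y ^+ 2 + 1) * (z ^+ 2 + 1)) * cross m n.
Proof.
rewrite -(opprB m) -[conic_pt m n z - m]opprB crossNN !conic_pt_to_apex.
rewrite cross_scale cross_apex_dirs.
have hy := sqr1_neq0 y; have hz := sqr1_neq0 z.
by field; rewrite hy hz.
Qed.

Lemma chord_dir_neq0 m n x y : cross m n != 0 -> chord_dir m n x y != 0.
Proof.
move=> mn; apply: (@cross_neq0l _ _ (m - x *: n)); rewrite cross_chord_apex.
by rewrite mulf_neq0 // oppr_eq0 sqr1_neq0.
Qed.

Lemma conic_pt_neq_apex m n t : cross m n != 0 -> conic_pt m n t != m.
Proof.
move=> mn; rewrite eq_sym -subr_eq0 conic_pt_to_apex scaler_eq0 negb_or.
rewrite mulf_neq0 ?invr_neq0 ?sqr1_neq0 ?pnatr_eq0 //=.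
have : cross (m - t *: n) (chord_dir m n t 0) != 0.
  by rewrite crossC cross_chord_apex oppr_eq0 mulf_neq0 // oppr_eq0 sqr1_neq0.
exact: cross_neq0l.
Qed.

Lemma conic_pt_inj m n : cross m n != 0 -> injective (conic_pt m n).
Proof.
move=> mn x y /eqP; rewrite -subr_eq0 conic_ptB scaler_eq0.
rewrite (negPf (chord_dir_neq0 x y mn)) orbF mulf_eq0 invr_eq0.
by rewrite mulf_eq0 pnatr_eq0 /= mulf_eq0 !(negPf (sqr1_neq0 _)) !orbF subr_eq0 => /eqP.
Qed.

Lemma triangle_cross A B C : cross (B - A) (C - A) != 0 -> triangle A B C.
Proof.
move=> bc; apply/eqP; rewrite -/(row_full _) -sub1mx; apply/row_subP => i.
set X : 'rV[R]_(2 + 1) := row i _.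
have XE : X = row_mx (lsubmx X) ((rsubmx X) 0 0)%:M by rewrite -mx11_scalar hsubmxK.
set w := rsubmx X 0 0 in XE; set u := lsubmx X in XE.
pose y := cross (u - w *: A) (C - A) / cross (B - A) (C - A).
pose z := cross (B - A) (u - w *: A) / cross (B - A) (C - A).
have -> : X = (w - y - z) *: affine_point A + y *: affine_point B + z *: affine_point C.
  rewrite affine_combination XE; congr row_mx; last by congr (_%:M); ring.
  rewrite /y /z; move: bc; clearbody u w; rewrite /cross !mxE => bc.
  by apply: rV2_ext; rewrite !mxE; field.
by rewrite !addmx_sub_adds ?scalemx_sub.
Qed.

Lemma triangle_neq A B C : triangle A B C -> [/\ A != B, B != C & C != A].
Proof.
rewrite /triangle => h.
have two (U V : 'rV[R]_(2 + 1)) :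
    (affine_point A + affine_point B + affine_point C <= U + V)%MS -> False.
  move=> /mxrankS; rewrite h => h2; have := leq_trans h2 (mxrank_adds_leqif U V).
  by move/leq_trans/(_ (leq_add (rank_leq_row U) (rank_leq_row V))).
split; apply/eqP => e.
- by apply: (two (affine_point B) (affine_point C)); rewrite e !addsmx_sub ?addsmxSl ?addsmxSr.
- by apply: (two (affine_point A) (affine_point C)); rewrite e !addsmx_sub ?addsmxSl ?addsmxSr.
- by apply: (two (affine_point A) (affine_point B)); rewrite e !addsmx_sub ?addsmxSl ?addsmxSr.
Qed.

End ConicParametrization.

(** * The tangency correspondence of nested ellipses *)

Section Correspondence.
Variable R : realType.
Implicit Types (u v w c m n A B C P V D T X : 'rV[R]_2) (x y z t s : R) (H : 'M[R]_2).

Definition conic_form (a b : R) u v : R :=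
  u 0 0 * v 0 0 / a ^+ 2 + u 0 1 * v 0 1 / b ^+ 2.

Lemma std_ellipseE (a b : R) X : std_ellipse a b X <-> conic_form a b X X = 1.
Proof. by rewrite /std_ellipse /conic_form /= !expr2. Qed.

Lemma std_ellipse_interiorE (a b : R) X :
  std_ellipse_interior a b X <-> conic_form a b X X < 1.
Proof. by rewrite /std_ellipse_interior /conic_form /= !expr2. Qed.

Lemma conic_form_ge0 (a b : R) X : 0 <= conic_form a b X X.
Proof. by rewrite /conic_form -!expr2 addr_ge0 // divr_ge0 ?sqr_ge0. Qed.

Lemma conic_form_line (a b k : R) V D :
  conic_form a b (V + k *: D) (V + k *: D) = conic_form a b V V
    + 2 * k * conic_form a b V D + k ^+ 2 * conic_form a b D D.
Proof. by rewrite /conic_form !mxE; ring. Qed.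

Lemma quadric_symmetric c H w : quadric c H (c + w) -> quadric c H (c - w).
Proof.
rewrite /quadric /= addrAC subrr add0r addrAC subrr add0r mulNmx.
by rewrite !dotE !mxE !mulrNN.
Qed.

(** A point V of the disc bounded by the inner quadric lies on a diameter of it,
    between the antipodal points c + w and c - w. Both are interior to the outer
    ellipse, which is convex, so V would be interior as well. *)
Lemma outside_nested (a b : R) c H V : H \in unitmx ->
  quadric c H `<=` std_ellipse_interior a b -> conic_form a b V V = 1 ->
  1 < dot ((V - c) *m H) ((V - c) *m H).
Proof.
move=> hH nest hV; rewrite ltNge; apply/negP => vle.
have [rho [w [r1 hw eV]]] : exists rho w,
    [/\ rho ^+ 2 <= 1, quadric c H (c + w) & V = c + rho *: w].
  (* At the centre every diameter will do; elsewhere take the one through V. *)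
  have [v0|v0] := eqVneq ((V - c) *m H) 0.
    exists 0, (delta_mx 0 0 *m invmx H); split.
    - by rewrite expr0n ler01.
    - rewrite /quadric /= addrAC subrr add0r mulmxKV // dotE !mxE /=; ring.
    - rewrite scale0r addr0; apply/eqP; rewrite -subr_eq0.
      by rewrite -(mulmxK hH (V - c)) v0 mul0mx.
  have d0 := dot_gt0 v0; set d := dot _ _ in vle d0.
  have s2 : Num.sqrt d ^+ 2 = d by rewrite sqr_sqrtr // ltW.
  have s0 : Num.sqrt d != 0 by rewrite gt_eqF // sqrtr_gt0.
  exists (Num.sqrt d), ((Num.sqrt d)^-1 *: (V - c)); split.
  - by rewrite s2.
  - rewrite /quadric /= addrAC subrr add0r -scalemxAl.
    have -> k u : dot (k *: u) (k *: u) = k ^+ 2 * dot u u by rewrite !dotE !mxE; ring.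
    by rewrite -/d -{2}s2 -exprMn mulVf // expr1n.
  - by rewrite scalerA divff // scale1r addrC subrK.
have h1 := nest _ hw; have h2 := nest _ (quadric_symmetric hw).
move/std_ellipse_interiorE in h1; move/std_ellipse_interiorE in h2.
have w0 := conic_form_ge0 a b w.
(* V is the convex combination of c + w and c - w with weights (1 + rho) / 2 and
   (1 - rho) / 2; the last term is the convexity defect. *)
have e : conic_form a b V V = (1 + rho) / 2 * conic_form a b (c + w) (c + w)
   + (1 - rho) / 2 * conic_form a b (c - w) (c - w) - (1 - rho ^+ 2) * conic_form a b w w.
  have -> : c - w = c + -1 *: w by rewrite scaleN1r.
  have -> : c + w = c + 1 *: w by rewrite scale1r.
  by rewrite eV !conic_form_line; field.
have rl : -1 <= rho <= 1.
  by rewrite -ler_norml -(@ler_pXn2r _ 2) ?nnegrE // expr1n real_normK ?num_real.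
have [rl0 rl1] := andP rl.
have q0 : 0 <= (1 - rho ^+ 2) * conic_form a b w w.
  by rewrite mulr_ge0 // subr_ge0.
move: e q0; rewrite hV; set x := conic_form _ _ (c + w) _ in h1 *.
set y := conic_form _ _ (c - w) _ in h2 *; set z := (1 - rho ^+ 2) * _.
clearbody x y z => e z0.
have [rge|rlt] := leP 0 rho.
  have p1 : 0 <= (1 - rho) * (1 - y) by rewrite mulr_ge0 //; lra.
  have p2 : 0 <= rho * (1 - x) by rewrite mulr_ge0 //; lra.
  nra.
have p1 : 0 <= (1 + rho) * (1 - x) by rewrite mulr_ge0 //; lra.
have p2 : 0 <= - rho * (1 - y) by rewrite mulr_ge0 //; lra.
nra.
Qed.

(** A tangent line of the outer ellipse contains no interior point, hence no point
    of the nested quadric. *)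
Lemma tangent_misses_nested (a b : R) c H V D : H \in unitmx ->
  quadric c H `<=` std_ellipse_interior a b -> conic_form a b V V = 1 ->
  conic_form a b V D = 0 -> D != 0 -> line_disc c H V D < 0.
Proof.
move=> hH nest hV hVD D0; rewrite ltNge; apply/negP => /(line_meets_quadric hH D0) [k].
move/nest/std_ellipse_interiorE.
rewrite conic_form_line hV hVD mulr0 addr0 ltNge lerDl mulr_ge0 ?sqr_ge0 //.
exact: conic_form_ge0.
Qed.

(** For fixed V the discriminant is a quadratic form in the direction, and its own
    discriminant is positive exactly when V lies outside the quadric: two tangent
    lines pass through V. *)
Lemma line_disc_pencil c H V D0 D1 : exists B : R,
  (forall x, line_disc c H V (x *: D1 + D0) =
     line_disc c H V D1 * x ^+ 2 + 2 * B * x + line_disc c H V D0) /\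
  B ^+ 2 - line_disc c H V D1 * line_disc c H V D0 =
    (dot ((V - c) *m H) ((V - c) *m H) - 1) * cross (D1 *m H) (D0 *m H) ^+ 2.
Proof.
exists (dot (D1 *m H) (D0 *m H)
  - cross ((V - c) *m H) (D1 *m H) * cross ((V - c) *m H) (D0 *m H)).
split=> [x|]; rewrite /line_disc ?mulmxDl -?scalemxAl;
  set v := (V - c) *m H; set d1 := D1 *m H; set d0 := D0 *m H; clearbody v d1 d0;
  by rewrite !dotE /cross ?mxE; ring.
Qed.

(** The zeros of q are the pairs of parameters whose chord is tangent to the
    quadric, including the chords through the point m of parameter infinity and the tangent
    line at m. *)
Definition is_tangency_biquad c H m n (q : biquad R) : Prop :=
  [/\ forall x y, line_disc c H (conic_pt m n y) (chord_dir m n x y) = bq_eval q x y,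
      forall t, line_disc c H m (m - t *: n) = bq_inf q t &
      line_disc c H m n = q02 q].

(** The line coordinates of the chord are x + y, 1 - x y and - (1 + x y) up to a
    linear change, and tangency is a quadratic condition on them. *)
Lemma tangency_biquad_exists c H m n : H \in unitmx -> exists q : biquad R,
  is_tangency_biquad c H m n q.
Proof.
move=> hH; have [k k0 kE] := cross_mulmx hH.
pose u := m *m H; pose v := n *m H.
(* k is the determinant of H, and r0 (1 + x y) + r1 (x + y) + r2 (1 - x y) is the
   cross product in line_disc; the coefficients below collect its square and the
   squared length of the image of the chord direction. *)
pose r0 := - k * cross m n; pose r1 := - k * cross c m; pose r2 := - k * cross c n.
exists (Biquad (dot v v - (r0 + r2) ^+ 2) (2 * dot u v - 2 * r1 * (r0 + r2))
  (- 2 * dot v v - 2 * (r0 + r2) * (r0 - r2)) (dot u u - r1 ^+ 2)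
  (- 2 * dot u v - 2 * r1 * (r0 - r2)) (dot v v - (r0 - r2) ^+ 2)).
rewrite /is_tangency_biquad /bq_eval /bq_inf /=; split=> [x y|t|].
- have hy := sqr1_neq0 y.
  rewrite /line_disc kE.
  have -> : cross (conic_pt m n y - c) (chord_dir m n x y) =
     - (1 + x * y) * cross m n - (x + y) * cross c m - (1 - x * y) * cross c n.
    by rewrite /cross !mxE; field.
  have -> : dot (chord_dir m n x y *m H) (chord_dir m n x y *m H) =
     (x + y) ^+ 2 * dot u u + 2 * (x + y) * (1 - x * y) * dot u v + (1 - x * y) ^+ 2 * dot v v.
    rewrite /chord_dir mulmxDl -!scalemxAl -/u -/v; clearbody u v.
    by rewrite !dotE !mxE; ring.
  by rewrite /r0 /r1 /r2; ring.
- rewrite /line_disc kE.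
  have -> : cross (m - c) (m - t *: n) = - t * cross m n - cross c m + t * cross c n.
    by rewrite /cross !mxE; ring.
  have -> : dot ((m - t *: n) *m H) ((m - t *: n) *m H) =
     dot u u - 2 * t * dot u v + t ^+ 2 * dot v v.
    rewrite mulmxBl -!scalemxAl -/u -/v; clearbody u v.
    by rewrite !dotE !mxE; ring.
  by rewrite /r0 /r1 /r2; ring.
- rewrite /line_disc kE.
  have -> : cross (m - c) n = cross m n - cross c n by rewrite /cross !mxE; ring.
  by rewrite -/v /r0 /r2; ring.
Qed.

End Correspondence.

(** * Poncelet triangles in terms of parameters *)

Section Hyperbolic.
Variable R : realType.
Implicit Types (u v w c m n A B C P V D T X : 'rV[R]_2) (x y z t s : R) (H : 'M[R]_2).

Definition conjugate_frame (a b : R) m n : Prop :=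
  [/\ conic_form a b m m = 1, conic_form a b n n = 1, conic_form a b m n = 0 &
      cross m n != 0].

Lemma conic_form_comb (a b x y z t : R) m n : conjugate_frame a b m n ->
  conic_form a b (x *: m + y *: n) (z *: m + t *: n) = x * z + y * t.
Proof.
case=> mm nn mn _.
have -> : conic_form a b (x *: m + y *: n) (z *: m + t *: n) =
  x * z * conic_form a b m m + (x * t + y * z) * conic_form a b m n
   + y * t * conic_form a b n n by rewrite /conic_form !mxE; ring.
by rewrite mm nn mn; ring.
Qed.

Lemma conic_ptE m n t : conic_pt m n t =
  ((t ^+ 2 - 1) / (t ^+ 2 + 1)) *: m + (2 * t / (t ^+ 2 + 1)) *: n.
Proof. by rewrite /conic_pt scalerDr !scalerA ![_^-1 * _]mulrC. Qed.

Lemma conic_pt_on (a b t : R) m n : conjugate_frame a b m n ->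
  conic_form a b (conic_pt m n t) (conic_pt m n t) = 1.
Proof.
move=> fr; rewrite conic_ptE (conic_form_comb _ _ _ _ fr).
have ht := sqr1_neq0 t; by field.
Qed.

Lemma conic_pt_tangent (a b t : R) m n : conjugate_frame a b m n ->
  conic_form a b (conic_pt m n t) (chord_dir m n t t) = 0.
Proof.
move=> fr; rewrite conic_ptE /chord_dir (conic_form_comb _ _ _ _ fr).
have ht := sqr1_neq0 t; by field.
Qed.

(** The inverse of the parametrization is the stereographic projection from m. *)
Lemma conic_pt_surj (a b : R) m n X : conjugate_frame a b m n ->
  conic_form a b X X = 1 -> X != m -> exists t, X = conic_pt m n t.
Proof.
move=> fr hX Xm; have [_ _ _ mn] := fr.
have [x [y eX]] : exists x y, X = x *: m + y *: n.
  exists (cross X n / cross m n), (cross m X / cross m n).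
  by move: mn; rewrite /cross => mn; apply: rV2_ext; rewrite !mxE; field.
have hxy : x * x + y * y = 1 by rewrite -hX eX (conic_form_comb _ _ _ _ fr).
have x1 : 1 - x != 0.
  apply: contraNneq Xm => x1; have ex : x = 1 by lra.
  have /eqP : y ^+ 2 = 0 by rewrite ex in hxy; lra.
  by rewrite sqrf_eq0 eX ex => /eqP ->; rewrite scale0r addr0 scale1r.
exists (y / (1 - x)); rewrite conic_ptE eX.
have ht := sqr1_neq0 (y / (1 - x)).
have e : (y / (1 - x)) ^+ 2 + 1 = 2 / (1 - x).
  by apply: (mulIf (expf_neq0 2 x1)); have := eq_comb hxy; apply; field.
have e2 : (y / (1 - x)) ^+ 2 - 1 = 2 * x / (1 - x).
  by rewrite -[LHS]addr0 -(subrr 1) addrACA e; field.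
by congr (_ *: _ + _ *: _); rewrite ?e2 e; field; rewrite x1.
Qed.

(** Tangent lines of the outer ellipse miss the inner one, and each point of the
    outer ellipse has two distinct tangent lines to the inner one. *)
Lemma hyperbolic_correspondence (a b : R) c H m n q : H \in unitmx ->
  quadric c H `<=` std_ellipse_interior a b -> conjugate_frame a b m n ->
  is_tangency_biquad c H m n q -> hyperbolic q.
Proof.
move=> hH nest fr [qE qI qN]; have [mm nn mn0 mn] := fr.
have [k k0 kE] := cross_mulmx hH.
have out t := outside_nested hH nest (conic_pt_on t fr).
have outm := outside_nested hH nest mm.
have n0 : n != 0 by move: mn; rewrite crossC oppr_eq0 => /cross_neq0l.
split.
- rewrite -qN; exact: (tangent_misses_nested hH nest mm mn0 n0).
- move=> t; rewrite -qE; apply: (tangent_misses_nested hH nest).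
  + exact: conic_pt_on. + exact: conic_pt_tangent. + exact: chord_dir_neq0.
- have [B [BE D]] := line_disc_pencil c H m m n.
  have qI' x : bq_inf q (- x) = q02 q * x ^+ 2 + 2 * B * x + bq_inf q 0.
    by rewrite -!qI -qN scaleNr opprK scale0r subr0 addrC BE.
  have b1 := qI' 1; have b2 := qI' (-1); have e0 := qI 0.
  rewrite scale0r subr0 in e0; rewrite qN e0 kE in D.
  have eB : 2 * B = - q11 q by move: b1 b2; rewrite /bq_inf => b1 b2; lra.
  have -> : q11 q ^+ 2 - 4 * (q02 q * q20 q) = 4 * (B ^+ 2 - q02 q * bq_inf q 0).
    by rewrite -(sqrrN (q11 q)) -eB /bq_inf; ring.
  rewrite D pmulr_rgt0 // pmulr_rgt0 ?subr_gt0 // exprn_even_gt0 //=.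
  by rewrite mulf_neq0 // crossC oppr_eq0.
- move=> y; have [B [BE D]] := line_disc_pencil c H (conic_pt m n y) (y *: m + n) (m - y *: n).
  have qE' x : bq_eval q x y = line_disc c H (conic_pt m n y) (m - y *: n) * x ^+ 2
      + 2 * B * x + line_disc c H (conic_pt m n y) (y *: m + n).
    rewrite -qE -BE; congr line_disc; rewrite /chord_dir.
    by apply: rV2_ext; rewrite !mxE; ring.
  have e0 := qE' 0; have e1 := qE' 1; have e2 := qE' (-1).
  rewrite !bq_evalE in e0 e1 e2.
  have eB : bq_lin q y = 2 * B by lra.
  have eI : bq_inf q y = line_disc c H (conic_pt m n y) (m - y *: n) by lra.
  have eC : bq_cst q y = line_disc c H (conic_pt m n y) (y *: m + n) by lra.
  rewrite eB eI eC exprMn -natrX -mulrBr D pmulr_rgt0 // pmulr_rgt0 ?subr_gt0 //.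
  rewrite exprn_even_gt0 //= kE mulf_neq0 //.
  have -> : cross (m - y *: n) (y *: m + n) = (y ^+ 2 + 1) * cross m n.
    by rewrite /cross !mxE; ring.
  by rewrite mulf_neq0 ?sqr1_neq0.
Qed.

Section PonceletTriangles.
Variables (a b : R) (c m n : 'rV[R]_2) (H : 'M[R]_2) (q : biquad R).
Hypotheses (hH : H \in unitmx) (fr : conjugate_frame a b m n)
           (hq : is_tangency_biquad c H m n q).

Let mn : cross m n != 0. Proof. by case: fr. Qed.

Lemma tangent_chord x y : x != y ->
  tangent_to (join_line (conic_pt m n x) (conic_pt m n y)) (quadric c H)
  <-> bq_eval q x y = 0.
Proof.
move=> xy; have [qE _ _] := hq.
have ne : conic_pt m n x != conic_pt m n y.
  by apply: contraNneq xy => /(conic_pt_inj mn) ->.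
apply: iff_trans (tangent_line_disc c hH ne) _.
rewrite conic_ptB -[conic_pt m n x]addr0.
rewrite -(scale0r (chord_dir m n y x)) line_disc_scale qE bq_evalC.
set k := _ ^+ 2; have k0 : k != 0.
  rewrite expf_neq0 // !mulf_neq0 ?invr_neq0 ?mulf_neq0 ?sqr1_neq0 //.
    by rewrite pnatr_eq0.
  by rewrite subr_eq0 eq_sym.
split=> [/eqP|->]; last by rewrite mulr0.
by rewrite mulf_eq0 (negPf k0) => /eqP.
Qed.

Lemma tangent_apex_disc t : line_disc c H m (conic_pt m n t - m) = 0 <-> bq_inf q t = 0.
Proof.
have [_ qI _] := hq; rewrite -[conic_pt m n t - m]opprB conic_pt_to_apex -scaleNr.
rewrite -[m in line_disc c H m]addr0.
rewrite -(scale0r (m - t *: n)) line_disc_scale qI.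
set k := _ ^+ 2; have k0 : k != 0.
  by rewrite expf_neq0 // oppr_eq0 mulf_neq0 ?invr_neq0 ?sqr1_neq0 ?pnatr_eq0.
split=> [/eqP|->]; last by rewrite mulr0.
by rewrite mulf_eq0 (negPf k0) => /eqP.
Qed.

Lemma tangent_from_apex t :
  tangent_to (join_line m (conic_pt m n t)) (quadric c H) <-> bq_inf q t = 0.
Proof.
apply: iff_trans (tangent_apex_disc t); apply: tangent_line_disc => //.
by rewrite eq_sym conic_pt_neq_apex.
Qed.

Lemma tangent_to_apex t :
  tangent_to (join_line (conic_pt m n t) m) (quadric c H) <-> bq_inf q t = 0.
Proof.
apply: iff_trans (tangent_apex_disc t).
apply: iff_trans (tangent_line_disc c hH (conic_pt_neq_apex t mn)) _.
have -> : line_disc c H m (conic_pt m n t - m) =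
  line_disc c H (conic_pt m n t + 1 *: (m - conic_pt m n t)) (-1 *: (m - conic_pt m n t)).
  by rewrite scale1r scaleN1r opprB subrKC.
by rewrite line_disc_scale sqrrN expr1n mul1r.
Qed.

Lemma poncelet_affineP t1 t2 t3 :
  poncelet_triangle (std_ellipse a b) (quadric c H)
    (conic_pt m n t1) (conic_pt m n t2) (conic_pt m n t3) <->
  [/\ t1 != t2, t2 != t3 & t3 != t1] /\
  [/\ bq_eval q t1 t2 = 0, bq_eval q t2 t3 = 0 & bq_eval q t3 t1 = 0].
Proof.
split.
  case=> /triangle_neq [n1 n2 n3] _ [h1 h2 h3].
  have d x y : conic_pt m n x != conic_pt m n y -> x != y.
    by apply: contraNneq => ->.
  have {}n1 := d _ _ n1; have {}n2 := d _ _ n2; have {}n3 := d _ _ n3.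
  by split; split=> //; apply/tangent_chord.
case=> [[n1 n2 n3] [h1 h2 h3]]; split.
- apply: triangle_cross; rewrite cross_conic_pts mulf_neq0 // mulf_neq0 //.
    by rewrite !mulf_neq0 ?pnatr_eq0 ?subr_eq0 // eq_sym.
  by rewrite invr_neq0 // !mulf_neq0 ?sqr1_neq0.
- by split; apply/std_ellipseE; apply: conic_pt_on.
- by split; apply/tangent_chord.
Qed.

Lemma poncelet_apexP z1 z2 :
  poncelet_triangle (std_ellipse a b) (quadric c H) m
    (conic_pt m n z1) (conic_pt m n z2) <->
  [/\ z1 != z2, bq_inf q z1 = 0, bq_inf q z2 = 0 & bq_eval q z1 z2 = 0].
Proof.
split.
  case=> /triangle_neq [n1 n2 n3] _ [h1 h2 h3].
  have {}n2 : z1 != z2 by apply: contraNneq n2 => ->.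
  by split=> //; [apply/tangent_from_apex | apply/tangent_to_apex | apply/tangent_chord].
case=> n2 h1 h2 h3; split.
- apply: triangle_cross; rewrite cross_apex_conic_pts mulf_neq0 // mulf_neq0 //.
    by rewrite !mulf_neq0 ?pnatr_eq0 ?subr_eq0.
  by rewrite invr_neq0 // !mulf_neq0 ?sqr1_neq0.
- case: fr => mm _ _ _.
  by split; apply/std_ellipseE => //; apply: conic_pt_on.
- by split; [apply/tangent_from_apex | apply/tangent_chord | apply/tangent_to_apex].
Qed.

End PonceletTriangles.

Lemma poncelet_triangle_rot (E Ec : set 'rV[R]_2) A B C :
  poncelet_triangle E Ec A B C -> poncelet_triangle E Ec B C A.
Proof.
case=> tri [h1 h2 h3] [k1 k2 k3]; split=> //.
rewrite /triangle in tri *; rewrite -tri.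
by rewrite addsmxC addsmxA.
Qed.

End Hyperbolic.

(** * The isogonal conjugate of the point of parameter infinity *)

Section IsogonalVector.
Variable R : realType.
Implicit Types (u v w c m n A B C P V D T : 'rV[R]_2) (x y z t s : R) (H : 'M[R]_2).
Implicit Types (X : 'rV[R]_(2 + 1)).

Lemma triangle_span A B C X : triangle A B C ->
  exists x y z, X = x *: affine_point A + y *: affine_point B + z *: affine_point C.
Proof.
move=> tri; have : (X <= affine_point A + affine_point B + affine_point C)%MS.
  by apply: submx_full; rewrite /row_full tri.
case/sub_addsmxP => -[Y Z] /= ->.
have /sub_adds_rV [x [y ->]] :
    (Y *m (affine_point A + affine_point B)%MS <= affine_point A + affine_point B)%MS.
  exact: submxMl.
by exists x, y, (Z 0 0); rewrite {1}[Z]mx11_scalar mul_scalar_mx.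
Qed.

(** Homogeneous coordinates in which the outer ellipse is the Veronese curve
    (1, t, t^2), the point m being (0, 0, 1). *)
Definition conic_frame m n x0 x1 x2 : 'rV[R]_(2 + 1) :=
  row_mx ((x2 - x0) *: m + (2 * x1) *: n) ((x0 + x2)%:M : 'M[R]_1).

Lemma conic_frame_pt m n t :
  (t ^+ 2 + 1) *: affine_point (conic_pt m n t) = conic_frame m n 1 t (t ^+ 2).
Proof.
have ht := sqr1_neq0 t.
rewrite scale_affine /conic_pt scalerA divff // scale1r.
by rewrite /conic_frame (addrC 1).
Qed.

Lemma conic_frameD m n x0 x1 x2 y0 y1 y2 (k l : R) :
  k *: conic_frame m n x0 x1 x2 + l *: conic_frame m n y0 y1 y2 =
  conic_frame m n (k * x0 + l * y0) (k * x1 + l * y1) (k * x2 + l * y2).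
Proof.
rewrite /conic_frame !scale_row_mx add_row_mx; congr row_mx.
  by apply: rV2_ext; rewrite !mxE; ring.
by apply/matrixP => i j; rewrite !ord1 !mxE /=; ring.
Qed.

Lemma conic_frameZ m n x0 x1 x2 (k : R) :
  k *: conic_frame m n x0 x1 x2 = conic_frame m n (k * x0) (k * x1) (k * x2).
Proof.
rewrite -[LHS]addr0 -(scale0r (conic_frame m n 0 0 0)) conic_frameD.
by rewrite !mul0r !addr0.
Qed.

Lemma cross_self u : cross u u = 0.
Proof. by rewrite /cross mulrC subrr. Qed.

Lemma conic_frame_inj m n x0 x1 x2 y0 y1 y2 : cross m n != 0 ->
  conic_frame m n x0 x1 x2 = conic_frame m n y0 y1 y2 ->
  [/\ x0 = y0, x1 = y1 & x2 = y2].
Proof.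
move=> mn /row_mx_scalar_inj [e e02].
have c1 : x2 - x0 = y2 - y0.
  apply: (mulIf mn).
  have := congr1 (fun w => cross w n) e.
  by rewrite !cross_linear_l cross_self !mulr0 !addr0.
have c2 : 2 * x1 = 2 * y1.
  apply: (mulIf mn).
  have := congr1 (fun w => cross w m) e.
  by rewrite !cross_linear_l cross_self (crossC n m) !mulr0 !add0r !mulrN => /oppr_inj.
by split; lra.
Qed.

Definition chord_sqnorm m n x y := dot (chord_dir m n x y) (chord_dir m n x y).

Lemma chord_sqnormE m n x y : chord_sqnorm m n x y =
  dot m m * (x + y) ^+ 2 + 2 * dot m n * ((x + y) * (1 - x * y))
  + dot n n * (1 - x * y) ^+ 2.
Proof. by rewrite /chord_sqnorm /chord_dir !dotE !mxE; ring. Qed.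

Lemma chord_sqnormC m n x y : chord_sqnorm m n x y = chord_sqnorm m n y x.
Proof. by rewrite /chord_sqnorm chord_dirC. Qed.

Lemma chord_sqnorm_gt0 m n x y : cross m n != 0 -> 0 < chord_sqnorm m n x y.
Proof. by move=> mn; apply/dot_gt0/chord_dir_neq0. Qed.

Definition frame_comb m n t1 t2 t3 y1 y2 y3 : 'rV[R]_(2 + 1) :=
  y1 *: conic_frame m n 1 t1 (t1 ^+ 2) + y2 *: conic_frame m n 1 t2 (t2 ^+ 2)
  + y3 *: conic_frame m n 1 t3 (t3 ^+ 2).

Lemma frame_comb_rot m n t1 t2 t3 y1 y2 y3 :
  frame_comb m n t1 t2 t3 y1 y2 y3 = frame_comb m n t2 t3 t1 y2 y3 y1.
Proof. by rewrite /frame_comb -addrA addrC. Qed.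

Lemma dotZ (k : R) u : dot (k *: u) (k *: u) = k ^+ 2 * dot u u.
Proof. by rewrite !dotE !mxE; ring. Qed.

(** All the lengths and areas of the barycentric equation factor through
    differences of parameters, because the apex m has parameter infinity and
    cross_chord_apex does not depend on the other end of the chord. *)
Lemma cevian_at_vertex m n t1 t2 t3 y1 y2 y3 : cross m n != 0 ->
  t1 != t2 -> t2 != t3 -> t3 != t1 ->
  (frame_comb m n t1 t2 t3 y1 y2 y3 <=
   reflected_cevian (conic_pt m n t1) (conic_pt m n t2) (conic_pt m n t3) m)%MS <->
  y2 * (t2 - t1) * chord_sqnorm m n t1 t2 + y3 * (t3 - t1) * chord_sqnorm m n t3 t1 = 0.
Proof.
move=> mn n12 n23 n31.
have h1 := sqr1_neq0 t1; have h2 := sqr1_neq0 t2; have h3 := sqr1_neq0 t3.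
have m12 : t2 - t1 != 0 by rewrite subr_eq0 eq_sym.
have m31 : t3 - t1 != 0 by rewrite subr_eq0.
rewrite /frame_comb -!conic_frame_pt !scalerA.
apply: iff_trans (reflected_cevian_barycentric _ _ _ _ _) _.
- rewrite cross_conic_pts mulf_neq0 // mulf_neq0 ?invr_neq0 ?mulf_neq0 ?subr_eq0 //.
  + by rewrite pnatr_eq0.
  + by rewrite eq_sym.
- by rewrite eq_sym conic_pt_neq_apex.
rewrite !conic_ptB conic_pt_to_apex !cross_scale !dotZ.
rewrite (chord_dirC m n t2) (chord_dirC m n t3) !cross_chord_apex.
rewrite -[dot (chord_dir _ _ t1 t2) _]/(chord_sqnorm m n t1 t2).
rewrite -[dot (chord_dir _ _ t1 t3) _]/(chord_sqnorm m n t1 t3) (chord_sqnormC m n t1 t3).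
set N2 := chord_sqnorm _ _ _ _; set N3 := chord_sqnorm _ _ _ _.
set d := cross m n in mn *.
(* The common factor of the two terms of the barycentric equation. *)
pose K := -16 * d * (t2 - t1) * (t3 - t1) / ((t1 ^+ 2 + 1) ^+ 3 * (t2 ^+ 2 + 1) * (t3 ^+ 2 + 1)).
have K0 : K != 0.
  rewrite /K !mulf_neq0 ?oppr_eq0 ?pnatr_eq0 // invr_neq0 // !mulf_neq0 // expf_neq0 //.
rewrite [X in X = 0](_ : _ = K * (y2 * (t2 - t1) * N2 + y3 * (t3 - t1) * N3)).
  split=> [/eqP|->]; last by rewrite mulr0.
  by rewrite mulf_eq0 (negPf K0) => /eqP.
by rewrite /K; field; rewrite h1 h2 h3.
Qed.

(** The barycentric coordinate l1^2 z2 z3 of the isogonal conjugate of m, up to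
    a factor symmetric in the three vertices, the vertices being scaled as in
    conic_frame_pt. *)
Definition isogonal_coord m n t1 t2 t3 : R :=
  chord_sqnorm m n t2 t3 / ((t1 - t2) * (t1 - t3)).

Definition isogonal_vec m n t1 t2 t3 : 'rV[R]_(2 + 1) :=
  frame_comb m n t1 t2 t3 (isogonal_coord m n t1 t2 t3)
    (isogonal_coord m n t2 t3 t1) (isogonal_coord m n t3 t1 t2).

(** Each cevian equation involves two coordinates and fixes their ratio, so any
    two of them determine the point, and the third one is then satisfied. *)
Lemma isogonal_conjugateP m n t1 t2 t3 X : cross m n != 0 ->
  t1 != t2 -> t2 != t3 -> t3 != t1 ->
  is_isogonal_conjugate (conic_pt m n t1) (conic_pt m n t2) (conic_pt m n t3) m X <->
  X != 0 /\ exists k, X = k *: isogonal_vec m n t1 t2 t3.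
Proof.
move=> mn n12 n23 n31.
have m12 : t1 - t2 != 0 by rewrite subr_eq0.
have m23 : t2 - t3 != 0 by rewrite subr_eq0.
have m31 : t3 - t1 != 0 by rewrite subr_eq0.
have h1 := sqr1_neq0 t1; have h2 := sqr1_neq0 t2; have h3 := sqr1_neq0 t3.
have tri : triangle (conic_pt m n t1) (conic_pt m n t2) (conic_pt m n t3).
  apply: triangle_cross; rewrite cross_conic_pts mulf_neq0 // mulf_neq0 ?invr_neq0 ?mulf_neq0 //.
  + by rewrite pnatr_eq0.
  + by rewrite -opprB oppr_eq0.
have [x1 [x2 [x3 eX]]] := triangle_span X tri.
have {eX} [y1 [y2 [y3 eX]]] : exists y1 y2 y3, X = frame_comb m n t1 t2 t3 y1 y2 y3.
  exists (x1 / (t1 ^+ 2 + 1)), (x2 / (t2 ^+ 2 + 1)), (x3 / (t3 ^+ 2 + 1)).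
  by rewrite /frame_comb -!conic_frame_pt !scalerA !divfK.
have apex t : m != conic_pt m n t by rewrite eq_sym conic_pt_neq_apex.
have c1 z1 z2 z3 := cevian_at_vertex z1 z2 z3 mn n12 n23 n31.
have c2 z1 z2 z3 := cevian_at_vertex z2 z3 z1 mn n23 n31 n12.
have c3 z1 z2 z3 := cevian_at_vertex z3 z1 z2 mn n31 n12 n23.
have N1 := chord_sqnorm_gt0 t2 t3 mn; have N2 := chord_sqnorm_gt0 t3 t1 mn.
have N3 := chord_sqnorm_gt0 t1 t2 mn.
have {}N1 := lt0r_neq0 N1; have {}N2 := lt0r_neq0 N2; have {}N3 := lt0r_neq0 N3.
rewrite /isogonal_vec /isogonal_coord.
set M1 := chord_sqnorm m n t2 t3 in c1 c2 c3 N1 *.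
set M2 := chord_sqnorm m n t3 t1 in c1 c2 c3 N2 *.
set M3 := chord_sqnorm m n t1 t2 in c1 c2 c3 N3 *.
clearbody M1 M2 M3.
split.
  case=> _ X0 [_ k2 k3]; split=> //; rewrite eX.
  rewrite eX frame_comb_rot in k2; move/c2: k2 => k2.
  rewrite eX -frame_comb_rot in k3; move/c3: k3 => k3.
  exists (y1 * (t1 - t2) * (t1 - t3) / M1).
  have e2 : y2 = - y1 * (t1 - t3) * M2 / ((t2 - t3) * M1).
    apply: (mulIf (mulf_neq0 m23 N1)); rewrite divfK ?mulf_neq0 //.
    by lincomb k3.
  have e3 : y3 = - y1 * (t1 - t2) * M3 / ((t3 - t2) * M1).
    have m32 : t3 - t2 != 0 by rewrite -opprB oppr_eq0.
    apply: (mulIf (mulf_neq0 m32 N1)); rewrite divfK ?mulf_neq0 //.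
    by lincomb k2.
  rewrite e2 e3 /frame_comb !scalerDr !scalerA.
  have m21 : t2 - t1 != 0 by rewrite -opprB oppr_eq0.
  have m32 : t3 - t2 != 0 by rewrite -opprB oppr_eq0.
  have m13 : t1 - t3 != 0 by rewrite -opprB oppr_eq0.
  by congr (_ *: _ + _ *: _ + _ *: _); field; rewrite ?N1 ?m12 ?m23 ?m21 ?m31 ?m32 ?m13.
case=> X0 [k e].
have m21 : t2 - t1 != 0 by rewrite -opprB oppr_eq0.
have m32 : t3 - t2 != 0 by rewrite -opprB oppr_eq0.
have m13 : t1 - t3 != 0 by rewrite -opprB oppr_eq0.
have e' : X = frame_comb m n t1 t2 t3 (k * (M1 / ((t1 - t2) * (t1 - t3))))
   (k * (M2 / ((t2 - t3) * (t2 - t1)))) (k * (M3 / ((t3 - t1) * (t3 - t2)))).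
  by rewrite e /frame_comb !scalerDr !scalerA.
rewrite e'; split.
- by split; apply: apex.
- by rewrite -e'.
split.
- by apply: (proj2 (c1 _ _ _)); field; rewrite ?m12 ?m23 ?m21 ?m31 ?m32 ?m13.
- by rewrite frame_comb_rot; apply: (proj2 (c2 _ _ _)); field; rewrite ?m12 ?m23 ?m21 ?m31 ?m32 ?m13.
- by rewrite -frame_comb_rot; apply: (proj2 (c3 _ _ _)); field; rewrite ?m12 ?m23 ?m21 ?m31 ?m32 ?m13.
Qed.

End IsogonalVector.

(** * The locus is a line minus a point *)

Section Locus.
Variable R : realType.
Implicit Types (u v w c m n A B C P V D T : 'rV[R]_2) (x y z t s : R) (H : 'M[R]_2).
Implicit Types (X : 'rV[R]_(2 + 1)).

(** The isogonal conjugate of m for the triangle whose parameters are the roots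
    of the cubic c3 x^3 + c2 x^2 + c1 x + c0, as a linear function of this cubic. *)
Definition cubic_isogonal m n (c3 c2 c1 c0 : R) : 'rV[R]_(2 + 1) :=
  conic_frame m n
    (dot m m * c3 + 2 * dot m n * c2 + dot n n * (c1 - 2 * c3))
    (dot m m * c2 - 2 * dot m n * c3 - dot n n * c0)
    (dot n n * c3 - dot m m * c1 - 2 * dot m n * c0).

Lemma cubic_isogonalD m n (k l c3 c2 c1 c0 d3 d2 d1 d0 : R) :
  k *: cubic_isogonal m n c3 c2 c1 c0 + l *: cubic_isogonal m n d3 d2 d1 d0 =
  cubic_isogonal m n (k * c3 + l * d3) (k * c2 + l * d2) (k * c1 + l * d1)
    (k * c0 + l * d0).
Proof. by rewrite conic_frameD /cubic_isogonal; congr conic_frame; ring. Qed.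

Lemma frame_combE m n t1 t2 t3 y1 y2 y3 :
  frame_comb m n t1 t2 t3 y1 y2 y3 =
  conic_frame m n (y1 + y2 + y3) (y1 * t1 + y2 * t2 + y3 * t3)
    (y1 * t1 ^+ 2 + y2 * t2 ^+ 2 + y3 * t3 ^+ 2).
Proof.
rewrite /frame_comb conic_frameD -[X in X + _ = _]scale1r conic_frameD.
by congr conic_frame; ring.
Qed.

(** The coordinates of isogonal_vec have the form g(t1) / F'(t1) + g(t2) / F'(t2)
    + g(t3) / F'(t3), with F the monic cubic with roots ti and g a polynomial with
    symmetric coefficients, so they are symmetric polynomials in the ti. Their
    degree in each ti is 1, so they are linear in the elementary symmetric
    functions. This is why a pencil of cubics yields a line. *)
Lemma isogonal_vecE m n t1 t2 t3 : t1 != t2 -> t2 != t3 -> t3 != t1 ->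
  isogonal_vec m n t1 t2 t3 =
  cubic_isogonal m n 1 (- (t1 + t2 + t3)) (t1 * t2 + t2 * t3 + t3 * t1)
    (- (t1 * t2 * t3)).
Proof.
move=> n12 n23 n31.
have m12 : t1 - t2 != 0 by rewrite subr_eq0.
have m23 : t2 - t3 != 0 by rewrite subr_eq0.
have m31 : t3 - t1 != 0 by rewrite subr_eq0.
have m21 : t2 - t1 != 0 by rewrite -opprB oppr_eq0.
have m32 : t3 - t2 != 0 by rewrite -opprB oppr_eq0.
have m13 : t1 - t3 != 0 by rewrite -opprB oppr_eq0.
rewrite /isogonal_vec frame_combE /isogonal_coord !chord_sqnormE /cubic_isogonal; congr conic_frame;
  by field; rewrite ?m12 ?m23 ?m31 ?m21 ?m32 ?m13.
Qed.

Definition apex_sqnorm m n t := dot (m - t *: n) (m - t *: n).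

(** Up to scaling, the limit of isogonal_vec when the third parameter goes to
    infinity. Only the vertices z1 and z2 contribute, so the limit lies on the
    base. *)
Lemma cubic_isogonal_apex m n (k z1 z2 : R) : z1 != z2 ->
  cubic_isogonal m n 0 k (- k * (z1 + z2)) (k * (z1 * z2)) =
  (k * apex_sqnorm m n z2 / (z1 - z2)) *: conic_frame m n 1 z1 (z1 ^+ 2)
  + (- k * apex_sqnorm m n z1 / (z1 - z2)) *: conic_frame m n 1 z2 (z2 ^+ 2).
Proof.
move=> n12; have m12 : z1 - z2 != 0 by rewrite subr_eq0.
have NE t : apex_sqnorm m n t = dot m m - 2 * dot m n * t + dot n n * t ^+ 2.
  by rewrite /apex_sqnorm !dotE !mxE; ring.
by rewrite conic_frameD /cubic_isogonal !NE; congr conic_frame; field.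
Qed.

Lemma dot_gram_gt0 m n : cross m n != 0 -> 0 < dot m m * dot n n - dot m n ^+ 2.
Proof. by move=> mn; rewrite lagrange2 addrC addKr exprn_even_gt0. Qed.

Lemma pencil_coefficients (q : biquad R) s t1 t2 t3 :
  (forall x, pencil_cubic q s x = (x - t1) * (x - t2) * (x - t3)) ->
  [/\ s * q02 q = - (t1 + t2 + t3),
      pencil_lin q + s * q11 q = t1 * t2 + t2 * t3 + t3 * t1 &
      pencil_cst q + s * q20 q = - (t1 * t2 * t3)].
Proof.
move=> h; have h0 := h 0; have h1 := h 1; have h2 := h (-1).
by rewrite /pencil_cubic /bq_inf in h0 h1 h2; split; nra.
Qed.

Lemma bq_diagonal (q : biquad R) t1 t2 t3 : t2 != t3 ->
  bq_eval q t1 t2 = 0 -> bq_eval q t3 t1 = 0 ->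
  bq_eval q t1 t1 = bq_inf q t1 * ((t1 - t2) * (t1 - t3)).
Proof.
move=> n23; rewrite bq_evalC => h2 h3; have e := bq_vieta n23 h2 h3.
by rewrite !bq_evalE in h2 *; lincomb (h2 +e (t1 - t2) *e e).
Qed.

Section Line.
Variables (a b : R) (c m n : 'rV[R]_2) (H : 'M[R]_2) (q : biquad R).
Hypotheses (hH : H \in unitmx) (fr : conjugate_frame a b m n)
           (hq : is_tangency_biquad c H m n q) (hyp : hyperbolic q) (qC : cayley q = 0).

Let mn : cross m n != 0. Proof. by case: fr. Qed.

(** The images of the two generators of the pencil of cubics; locus_limit comes
    from the triangle having m as a vertex. *)
Definition locus_base := cubic_isogonal m n 1 0 (pencil_lin q) (pencil_cst q).
Definition locus_limit := cubic_isogonal m n 0 (q02 q) (q11 q) (q20 q).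

Lemma locus_memberP X :
  isogonal_locus (std_ellipse a b) (quadric c H) m X <->
  X != 0 /\ exists k s, X = k *: (locus_base + s *: locus_limit).
Proof.
have member s t1 t2 t3 : t1 != t2 -> t2 != t3 -> t3 != t1 ->
    (forall x, pencil_cubic q s x = (x - t1) * (x - t2) * (x - t3)) ->
    isogonal_vec m n t1 t2 t3 = locus_base + s *: locus_limit.
  move=> n12 n23 n31 /pencil_coefficients [e2 e1 e0].
  rewrite isogonal_vecE // -e2 -e1 -e0 -[locus_base]scale1r cubic_isogonalD.
  by congr cubic_isogonal; ring.
split.
  case=> A [B [C [pon iso]]]; have [[PA PB PC] X0 _] := iso.
  have [_ [EA EB EC] _] := pon.
  have param Y : std_ellipse a b Y -> m != Y -> exists t, Y = conic_pt m n t.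
    by move=> /std_ellipseE EY mY; apply: (conic_pt_surj fr EY); rewrite eq_sym.
  have [t1 e1] := param _ EA PA; have [t2 e2] := param _ EB PB.
  have [t3 e3] := param _ EC PC; subst A B C.
  have [[n12 n23 n31] [h12 h23 h31]] := proj1 (poncelet_affineP hH fr hq t1 t2 t3) pon.
  have [s /(member _ _ _ _ n12 n23 n31) e] :=
    triangle_in_pencil hyp qC n12 n23 n31 h12 h23 h31.
  have [_ [k eX]] := proj1 (isogonal_conjugateP X mn n12 n23 n31) iso.
  by split=> //; exists k, s; rewrite -e.
case=> X0 [k [s eX]].
have [t1 [t2 [t3 [[n12 n23 n31] fac zeros]]]] := pencil_member_splits s hyp qC.
exists (conic_pt m n t1), (conic_pt m n t2), (conic_pt m n t3); split.
  exact/(poncelet_affineP hH fr hq).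
apply/isogonal_conjugateP => //; split=> //; exists k.
by rewrite (member s).
Qed.

(** In Veronese coordinates, a line through the points of parameters z1 and z2 is
    given by the quadratic polynomial with these roots: this is the equation of
    the base of the triangle with apex m. *)
Definition base_form (x0 x1 x2 : R) : R := q20 q * x0 + q11 q * x1 + q02 q * x2.

(** The form vanishes at locus_limit, so only its value d at locus_base matters.
    Computed on the triangle of the member s = 0, d is the sum over the vertices
    of positive multiples of bq_eval q t t, which are all negative. *)
Lemma base_form_on_line : exists2 d, d != 0 &
  forall k l x0 x1 x2, k *: locus_base + l *: locus_limit = conic_frame m n x0 x1 x2 ->
  base_form x0 x1 x2 = k * d.
Proof.
have [t1 [t2 [t3 [[n12 n23 n31] fac [z12 z23 z31]]]]] := pencil_member_splits 0 hyp qC.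
have [_ qd _ _] := hyp.
have [y0 [y1 [y2 eb]]] : exists y0 y1 y2, locus_base = conic_frame m n y0 y1 y2.
  by do 3 eexists; rewrite /locus_base /cubic_isogonal.
exists (base_form y0 y1 y2); last first.
  move=> k l x0 x1 x2; rewrite eb conic_frameD => /(conic_frame_inj mn) [<- <- <-].
  by rewrite /base_form; ring.
have := isogonal_vecE m n n12 n23 n31.
have [e2 e1 e0] := pencil_coefficients fac.
rewrite -e2 -e1 -e0 !mul0r !addr0 -/locus_base eb.
rewrite /isogonal_vec frame_combE; case/(conic_frame_inj mn) => <- <- <-.
(* The contribution of a vertex is N bq_eval q x x / F'(x)^2, with N the squared
   length of the opposite chord direction and F the monic cubic of the triangle. *)
have sgn x y z : x != y -> y != z -> z != x -> bq_eval q x y = 0 -> bq_eval q z x = 0 ->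
    isogonal_coord m n x y z * bq_inf q x < 0.
  move=> nxy nyz nzx zy zz.
  have mxy : x - y != 0 by rewrite subr_eq0.
  have mxz : x - z != 0 by rewrite subr_eq0 eq_sym.
  have dg := bq_diagonal nyz zy zz.
  have -> : isogonal_coord m n x y z * bq_inf q x =
      chord_sqnorm m n y z / ((x - y) * (x - z)) ^+ 2 * bq_eval q x x.
    by rewrite dg /isogonal_coord; field; rewrite mxy mxz.
  rewrite pmulr_rlt0 // divr_gt0 ?chord_sqnorm_gt0 // exprn_even_gt0 //=.
  by rewrite mulf_neq0.
have s1 := sgn _ _ _ n12 n23 n31 z12 z31.
have s2 := sgn _ _ _ n23 n31 n12 z23 z12.
have s3 := sgn _ _ _ n31 n12 n23 z31 z23.
rewrite lt_eqF //; move: s1 s2 s3; rewrite /base_form /bq_inf.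
set p1 := isogonal_coord m n t1 t2 t3; set p2 := isogonal_coord m n t2 t3 t1.
by set p3 := isogonal_coord m n t3 t1 t2; clearbody p1 p2 p3 => s1 s2 s3; nra.
Qed.
(** If it were zero, bq_inf would be proportional to |m - t n|^2, a quadratic
    polynomial in t without real roots. *)
Lemma locus_limit_neq0 : locus_limit != 0.
Proof.
apply/eqP => e0; have [q0 _ D _] := hyp; have g := dot_gram_gt0 mn.
have n0 : 0 < dot n n.
  by apply: dot_gt0; move: mn; rewrite crossC oppr_eq0 => /cross_neq0l.
have : locus_limit = conic_frame m n 0 0 0.
  by rewrite e0 -(scale0r (conic_frame m n 0 0 0)) conic_frameZ !mul0r.
case/(conic_frame_inj mn) => z0 z1 _.
(* If bq_inf is proportional to |m - t n|^2, its discriminant is a negative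
   multiple of the Gram determinant of m and n. *)
have : 0 <= - (q02 q ^+ 2) * (dot m m * dot n n - dot m n ^+ 2).
  have -> : - (q02 q ^+ 2) * (dot m m * dot n n - dot m n ^+ 2) =
      dot n n ^+ 2 * (q11 q ^+ 2 - 4 * (q02 q * q20 q)) / 4.
    have e1 : dot n n * q11 q = - 2 * dot m n * q02 q by lincomb z0.
    have e2 : dot n n * q20 q = dot m m * q02 q by lincomb (-1 *e z1).
    have -> : dot n n ^+ 2 * (q11 q ^+ 2 - 4 * (q02 q * q20 q)) =
       (dot n n * q11 q) ^+ 2 - 4 * q02 q * dot n n * (dot n n * q20 q) by ring.
    by rewrite e1 e2; field.
  by rewrite divr_ge0 // mulr_ge0 ?exprn_ge0 ?ltW.
rewrite leNgt nmulr_rlt0 ?g // oppr_lt0 exprn_even_gt0 //=.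
by rewrite lt_eqF.
Qed.

Lemma line_coords_inj (k l k' l' : R) :
  k *: locus_base + l *: locus_limit = k' *: locus_base + l' *: locus_limit ->
  k = k' /\ l = l'.
Proof.
have [d d0 dE] := base_form_on_line => e.
have [x0 [x1 [x2 ex]]] : exists x0 x1 x2,
    k *: locus_base + l *: locus_limit = conic_frame m n x0 x1 x2.
  by do 3 eexists; rewrite cubic_isogonalD.
have ek := dE _ _ _ _ _ ex; rewrite e in ex; have := dE _ _ _ _ _ ex.
rewrite ek => /(mulIf d0) kk; split=> //; rewrite kk in e.
move/addrI/eqP: e; rewrite -subr_eq0 -scalerBl scaler_eq0.
by rewrite (negPf locus_limit_neq0) orbF subr_eq0 => /eqP.
Qed.

Lemma locus_base_notin_limit : ~~ (locus_base <= locus_limit)%MS.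
Proof.
apply/negP => /sub_rVP [k e].
have : 1 *: locus_base + 0 *: locus_limit = 0 *: locus_base + k *: locus_limit.
  by rewrite scale1r !scale0r addr0 add0r.
by case/line_coords_inj => /eqP; rewrite oner_eq0.
Qed.

Definition locus_line : 'M[R]_(2 + 1) := (locus_base + locus_limit)%MS.

Lemma rank_locus_line : \rank locus_line = 2%N.
Proof.
apply/eqP; rewrite eqn_leq; apply/andP; split.
  apply: leq_trans (mxrank_adds_leqif _ _) _.
  exact: leq_add (rank_leq_row _) (rank_leq_row _).
have r1 : \rank locus_limit = 1%N by rewrite rank_rV locus_limit_neq0.
apply: leq_trans (_ : \rank locus_limit < _)%N; first by rewrite r1.
by apply: rank_ltmx; rewrite ltmxE addsmxSr addsmx_sub (negPf locus_base_notin_limit).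
Qed.

Lemma locus_punctured_line X :
  isogonal_locus (std_ellipse a b) (quadric c H) m X <->
  [/\ X != 0, (X <= locus_line)%MS & ~~ (X == locus_limit)%MS].
Proof.
apply: iff_trans (locus_memberP X) _; split.
  case=> X0 [k [s eX]]; have k0 : k != 0.
    by apply: contraNneq X0 => k0; rewrite eX k0 scale0r.
  have {}eX : X = k *: locus_base + (k * s) *: locus_limit.
    by rewrite eX scalerDr scalerA.
  split=> //; first by apply/sub_adds_rV; exists k, (k * s).
  apply/negP => /andP [/sub_rVP [j eX'] _].
  have : k *: locus_base + (k * s) *: locus_limit
      = 0 *: locus_base + j *: locus_limit by rewrite -eX eX' scale0r add0r.
  by case/line_coords_inj => /eqP; rewrite (negPf k0).
case=> X0 /sub_adds_rV [k [l eX]] nX; split=> //.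
have k0 : k != 0.
  apply: contraNneq nX => k0; move: eX; rewrite k0 scale0r add0r => eX.
  have l0 : l != 0 by apply: contraNneq X0 => l0; rewrite eX l0 scale0r.
  by rewrite eX; apply/eqmxP/eqmx_scale.
by exists k, (l / k); rewrite scalerDr scalerA mulrCA divff // mulr1.
Qed.

Lemma base_vertices_exist : exists z1 z2,
  [/\ z1 != z2, bq_inf q z1 = 0, bq_inf q z2 = 0 & bq_eval q z1 z2 = 0].
Proof.
have [q0 _ D _] := hyp; have q0' : q02 q != 0 by rewrite lt_eqF.
have [z1 [z2 [n12 fac]]] := quadratic_roots q0' D.
have facI x : bq_inf q x = q02 q * (x - z1) * (x - z2) by rewrite -fac /bq_inf; ring.
have i1 : bq_inf q z1 = 0 by rewrite facI subrr mulr0 mul0r.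
have i2 : bq_inf q z2 = 0 by rewrite facI subrr mulr0.
exists z1, z2; split=> //; apply: (mulfI q0').
by rewrite -(cayley_at_infinity n12 i1 i2) qC mulr0.
Qed.

(** base_form vanishes on the base, and on the locus line it vanishes at
    locus_limit only, so the two lines are distinct and meet there. *)
Lemma limit_on_base z1 z2 : z1 != z2 -> bq_inf q z1 = 0 -> bq_inf q z2 = 0 ->
  (locus_limit == locus_line :&: join_line (conic_pt m n z1) (conic_pt m n z2))%MS.
Proof.
move=> n12 i1 i2; have [e11 e20] := bq_inf_vieta n12 i1 i2.
apply/andP; split.
  rewrite sub_capmx addsmxSr /=; apply/sub_adds_rV.
  rewrite /locus_limit e11 e20 mulNr -mulNr cubic_isogonal_apex //.
  by rewrite -!conic_frame_pt !scalerA; do 2 eexists.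
apply/rV_subP => X; rewrite sub_capmx => /andP [/sub_adds_rV [k [l eX]]].
case/sub_adds_rV => k' [l' eX'].
have [d d0 dE] := base_form_on_line.
have h1 := sqr1_neq0 z1; have h2 := sqr1_neq0 z2.
have {}eX' : X = conic_frame m n (k' / (z1 ^+ 2 + 1) + l' / (z2 ^+ 2 + 1))
   (k' / (z1 ^+ 2 + 1) * z1 + l' / (z2 ^+ 2 + 1) * z2)
   (k' / (z1 ^+ 2 + 1) * z1 ^+ 2 + l' / (z2 ^+ 2 + 1) * z2 ^+ 2).
  rewrite eX' -[X in conic_frame _ _ (X + _)]mulr1 -[X in conic_frame _ _ (_ + X)]mulr1.
  by rewrite -conic_frameD -!conic_frame_pt !scalerA !divfK.
rewrite eX in eX'; have := dE _ _ _ _ _ eX'.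
have -> : base_form (k' / (z1 ^+ 2 + 1) + l' / (z2 ^+ 2 + 1))
   (k' / (z1 ^+ 2 + 1) * z1 + l' / (z2 ^+ 2 + 1) * z2)
   (k' / (z1 ^+ 2 + 1) * z1 ^+ 2 + l' / (z2 ^+ 2 + 1) * z2 ^+ 2) =
   k' / (z1 ^+ 2 + 1) * bq_inf q z1 + l' / (z2 ^+ 2 + 1) * bq_inf q z2.
  by rewrite /base_form /bq_inf; ring.
rewrite i1 i2 !mulr0 addr0 => /esym/eqP; rewrite mulf_eq0 (negPf d0) orbF => /eqP k0.
by rewrite eX k0 scale0r add0r scalemx_sub.
Qed.

(** The coordinate that vanishes on the line at infinity is, on cubic_isogonal, the
    imaginary part of a complex constant times the value of the cubic at i. The
    constant is not zero because the ellipse is not a circle. If the coordinate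
    vanished on the whole pencil, some member would vanish at i, hence would be
    divisible by x^2 + 1, although all its roots are real and distinct. *)
Lemma line_not_at_infinity : (dot m m != dot n n) || (dot m n != 0) ->
  ~~ (locus_line == line_at_infinity)%MS.
Proof.
move=> noncirc; apply/negP => /andP [sub _].
have last0 x0 x1 x2 : (conic_frame m n x0 x1 x2 <= (line_at_infinity : 'M[R]_(2, 2 + 1)))%MS ->
    x0 + x2 = 0.
  case/submxP => Y; rewrite mul_mx_row mulmx0 => /eq_row_mx [_ /matrixP/(_ 0 0)].
  by rewrite !mxE.
have /last0 w0 := submx_trans (addsmxSl locus_base locus_limit) sub.
have /last0 w1 := submx_trans (addsmxSr locus_base locus_limit) sub.
pose g := dot m m - dot n n; pose h := 2 * dot m n.
have gh : (g != 0) || (h != 0).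
  by rewrite subr_eq0 mulf_eq0 pnatr_eq0.
have {}w0 : g * (1 - pencil_lin q) - h * pencil_cst q = 0.
  by rewrite -w0 /g /h; ring.
have {}w1 : g * q11 q = h * (q02 q - q20 q).
  by rewrite /g /h; lincomb (-1 *e w1).
clearbody g h.
have [q0 _ D _] := hyp.
(* These are the two real equations saying that the member s vanishes at i. They
   are compatible because w0 and w1 make F(i) and bq_inf(i) parallel, and
   bq_inf(i) is not zero. *)
have [s [e1 e2]] : exists s, pencil_lin q + s * q11 q = 1 /\
    pencil_cst q + s * q20 q = s * q02 q.
  have par : (1 - pencil_lin q) * (q02 q - q20 q) = pencil_cst q * q11 q.
    case/orP: gh => [g0|h0].
      by apply: (mulfI g0); lincomb ((q02 q - q20 q) *e w0 +e (- pencil_cst q) *e w1).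
    by apply: (mulfI h0); lincomb (q11 q *e w0 +e (- (1 - pencil_lin q)) *e w1).
  have [z11|n11] := eqVneq (q11 q) 0; last first.
    exists ((1 - pencil_lin q) / q11 q); split; first by field.
    apply: (mulIf n11).
    have := eq_comb (-1 *e par); apply; field.
    by [].
  have n02 : q02 q - q20 q != 0.
    apply/eqP => e; have ee : q20 q = q02 q by lincomb (-1 *e e).
    by move: D; rewrite z11 ee expr0n /= sub0r oppr_gt0 pmulr_rlt0 // -expr2 ltNge sqr_ge0.
  exists (pencil_cst q / (q02 q - q20 q)); split; last by field.
  rewrite z11 mulr0 addr0.
  have /eqP := par; rewrite z11 mulr0 mulf_eq0 (negPf n02) orbF subr_eq0 => /eqP <-.
  by [].
have [t1 [t2 [t3 [[n12 _ _] fac _]]]] := pencil_member_splits s hyp qC.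
(* The member s is divisible by x^2 + 1, so it has a single real root. *)
have fac' x : pencil_cubic q s x = (x ^+ 2 + 1) * (x + s * q02 q).
  rewrite /pencil_cubic /bq_inf.
  have -> : x ^+ 3 + pencil_lin q * x + pencil_cst q
      + s * (q20 q + q11 q * x + q02 q * x ^+ 2) =
    x ^+ 3 + (pencil_lin q + s * q11 q) * x + (pencil_cst q + s * q20 q)
      + s * q02 q * x ^+ 2 by ring.
  by rewrite e1 e2; ring.
have rt x : pencil_cubic q s x = 0 -> x = - (s * q02 q).
  by move/eqP; rewrite fac' mulf_eq0 (negPf (sqr1_neq0 x)) /= addr_eq0 => /eqP.
have r1 : t1 = - (s * q02 q) by apply: rt; rewrite fac subrr !mul0r.
have r2 : t2 = - (s * q02 q) by apply: rt; rewrite fac subrr mulr0 mul0r.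
by case/eqP: n12; rewrite r1 r2.
Qed.

End Line.

Lemma cayley_of_poncelet (a b : R) c m n H q A B C : H \in unitmx ->
  conjugate_frame a b m n -> is_tangency_biquad c H m n q ->
  poncelet_triangle (std_ellipse a b) (quadric c H) A B C -> cayley q = 0.
Proof.
move=> hH fr hq pon.
have param Y : std_ellipse a b Y -> m != Y -> exists t, Y = conic_pt m n t.
  by move=> /std_ellipseE EY mY; apply: (conic_pt_surj fr EY); rewrite eq_sym.
have apex B' C' : poncelet_triangle (std_ellipse a b) (quadric c H) m B' C' -> cayley q = 0.
  move=> pon'; have [/triangle_neq [mB BC Cm] [_ EB EC] _] := pon'.
  rewrite eq_sym in Cm.
  have [z1 e1] := param _ EB mB; have [z2 e2] := param _ EC Cm; subst B' C'.
  have [n12 i1 i2 e] := proj1 (poncelet_apexP hH fr hq z1 z2) pon'.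
  by rewrite (cayley_at_infinity n12 i1 i2) e mulr0.
have [mA|nA] := eqVneq m A; first by apply: (apex B C); rewrite mA.
have [mB|nB] := eqVneq m B.
  by apply: (apex C A); rewrite mB; apply: poncelet_triangle_rot.
have [mC|nC] := eqVneq m C.
  by apply: (apex A B); rewrite mC; do 2 apply: poncelet_triangle_rot.
have [_ [EA EB EC] _] := pon.
have [t1 e1] := param _ EA nA; have [t2 e2] := param _ EB nB.
have [t3 e3] := param _ EC nC; subst A B C.
have [[n12 n23 n31] [h12 h23 h31]] := proj1 (poncelet_affineP hH fr hq t1 t2 t3) pon.
exact: cayley_of_triangle h12 h23 h31.
Qed.

Definition conjugate_radius (a b : R) m : 'rV[R]_2 :=
  \row_j (if j == 0 then - (a / b) * m 0 1 else b / a * m 0 0).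

Lemma conjugate_radius_frame (a b : R) m : 0 < a -> 0 < b ->
  conic_form a b m m = 1 -> conjugate_frame a b m (conjugate_radius a b m).
Proof.
move=> a0 b0 mm; have a0' : a != 0 by rewrite gt_eqF.
have b0' : b != 0 by rewrite gt_eqF.
split=> //.
- by rewrite -mm /conic_form !mxE /=; field; rewrite a0' b0'.
- by rewrite /conic_form !mxE /=; field; rewrite a0' b0'.
- have -> : cross m (conjugate_radius a b m) = a * b * conic_form a b m m.
    by rewrite /cross /conic_form !mxE /=; field; rewrite a0' b0'.
  by rewrite mm mulr1 mulf_neq0.
Qed.

(** Seen as complex numbers, m and the conjugate radius n satisfy
    |m^2 + n^2| = a^2 - b^2, a form of Apollonius' relations. *)
Lemma conjugate_radius_anisotropic (a b : R) m : 0 < b -> b < a ->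
  conic_form a b m m = 1 ->
  (dot m m != dot (conjugate_radius a b m) (conjugate_radius a b m))
  || (dot m (conjugate_radius a b m) != 0).
Proof.
move=> b0 ba mm; have a0 : 0 < a := lt_trans b0 ba.
have a0' : a != 0 by rewrite gt_eqF.
have b0' : b != 0 by rewrite gt_eqF.
rewrite -negb_and; apply/negP => /andP [/eqP e /eqP f].
have : (a ^+ 2 - b ^+ 2) ^+ 2 * conic_form a b m m ^+ 2 = 0.
  have -> : (a ^+ 2 - b ^+ 2) ^+ 2 * conic_form a b m m ^+ 2 =
     (dot m m - dot (conjugate_radius a b m) (conjugate_radius a b m)) ^+ 2
     + 4 * dot m (conjugate_radius a b m) ^+ 2.
    by rewrite !dotE /conic_form !mxE /=; field; rewrite a0' b0'.
  by rewrite e f subrr !expr0n /= mulr0 addr0.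
move/eqP; rewrite mm expr1n mulr1 sqrf_eq0 subr_eq0 eqrXn2 ?ltW //.
by move/eqP => e'; rewrite e' ltxx in ba.
Qed.

End Locus.

Theorem proposition3 (R : realType) (a b : R) (hb : 0 < b) (hab : b < a)
    (Ec : set 'rV[R]_2) (hEc : is_ellipse Ec)
    (hnested : Ec `<=` std_ellipse_interior a b)
    (hT : exists A B C, poncelet_triangle (std_ellipse a b) Ec A B C)
    (P : 'rV[R]_2) (hP : std_ellipse a b P) :
  exists (L : 'M[R]_(2 + 1)) (Q : 'rV[R]_(2 + 1)),
    [/\ \rank L = 2%N /\ ~~ (L == line_at_infinity)%MS,
        Q != 0,
        isogonal_locus (std_ellipse a b) Ec P =
          [set X | [/\ X != 0, (X <= L)%MS & ~~ (X == Q)%MS]],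
        exists Z1 Z2, poncelet_triangle (std_ellipse a b) Ec P Z1 Z2 &
        forall Z1 Z2, poncelet_triangle (std_ellipse a b) Ec P Z1 Z2 ->
          (Q == L :&: join_line Z1 Z2)%MS].
Proof.
have [c [H [hH eEc]]] := is_ellipse_quadric hEc; subst Ec.
have a0 : 0 < a := lt_trans hb hab.
have mm := proj1 (std_ellipseE a b P) hP.
pose n := conjugate_radius a b P.
have fr : conjugate_frame a b P n := conjugate_radius_frame a0 hb mm.
have [q hq] := tangency_biquad_exists c P n hH.
have hyp : hyperbolic q := hyperbolic_correspondence hH hnested fr hq.
have [A0 [B0 [C0 pon0]]] := hT.
have qC : cayley q = 0 := cayley_of_poncelet hH fr hq pon0.
exists (locus_line P n q), (locus_limit P n q); split.
- split; first exact: (rank_locus_line fr hyp qC).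
  apply: (line_not_at_infinity hyp qC).
  exact: conjugate_radius_anisotropic.
- exact: (locus_limit_neq0 fr hyp).
- by apply/seteqP; split => X /(locus_punctured_line hH fr hq hyp qC).
- have [z1 [z2 hz]] := base_vertices_exist hyp qC.
  by exists (conic_pt P n z1), (conic_pt P n z2); apply/(poncelet_apexP hH fr hq).
- move=> Z1 Z2 pon; have [/triangle_neq [PZ1 _ Z2P] [_ E1 E2] _] := pon.
  rewrite eq_sym in PZ1.
  have [z1 e1] := conic_pt_surj fr (proj1 (std_ellipseE a b Z1) E1) PZ1.
  have [z2 e2] := conic_pt_surj fr (proj1 (std_ellipseE a b Z2) E2) Z2P.
  subst Z1 Z2; have [n12 i1 i2 _] := proj1 (poncelet_apexP hH fr hq z1 z2) pon.
  exact: (limit_on_base fr hyp qC).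
Qed.
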